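(* Let $A,B\in K(H)^+$ with $B\in\mathcal{D}$ and $\operatorname{Tr} R_B^\perp\le \operatorname{Tr} R_A^\perp$. If for some $p\in\{0,1,2,\ldots\}\cup\{\infty\}$ one has $s(B)\prec_p s(A)$ and $\operatorname{Tr} R_A^\perp\le \operatorname{Tr} R_B^\perp+p$, then $B\in E(\mathcal{U}(A))$.
   Context: $H$ is a complex Hilbert space, finite dimensional or separable infinite dimensional, with a fixed orthonormal basis $\{e_n\}$. $K(H)^+$ is the set of positive (i.e. positive semidefinite) compact operators on $H$. $\mathcal{D}\subseteq B(H)$ is the algebra of operators that are diagonal with respect to $\{e_n\}$. $E:B(H)\to\mathcal{D}$ is the canonical conditional expectation: $E(X)$ is the diagonal operator with $\langle E(X)e_n,e_n\rangle=\langle Xe_n,e_n\rangle$ for all $n$. $\mathcal{U}(A)=\{UAU^*\mid U\in B(H)\text{ unitary}\}$ is the unitary orbit of $A$, and $E(\mathcal{U}(A))=\{E(X)\mid X\in\mathcal{U}(A)\}$. For self-adjoint $A$, $R_A$ is the orthogonal projection onto $\overline{\operatorname{ran}A}$ and $R_A^\perp=I-R_A$ is the projection onto $\ker A$, so $\operatorname{Tr}R_A^\perp=\dim\ker A\in\{0,1,2,\ldots\}\cup\{\infty\}$ (with $\infty\le\infty$ and $n+\infty=\infty$). For $A\in K(H)^+$, $s(A)=(s_j(A))_{j\ge1}$ is the nonincreasing sequence of singular values of $A$: the nonzero eigenvalues listed in decreasing order with multiplicity, followed by zeros if $A$ has finite rank (and having no zeros if $A$ has infinite rank). For nonnegative nonincreasing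 sequences $\xi,\eta$ converging to $0$: - Majorization $\xi\prec\eta$ means $\sum_{j=1}^n\xi_j\le\sum_{j=1}^n\eta_j$ for all $n\in\mathbb{N}$ and $\sum_{j=1}^\infty\xi_j=\sum_{j=1}^\infty\eta_j$ (both sums possibly $\infty$). - For an integer $0\le p<\infty$, $p$-majorization $\xi\prec_p\eta$ means $\xi\prec\eta$ and there exists $N_p\in\mathbb{N}$ such that $\sum_{k=1}^{n+p}\xi_k\le\sum_{k=1}^n\eta_k$ for all $n\ge N_p$. - $\infty$-majorization $\xi\prec_\infty\eta$ means $\xi\prec_p\eta$ for all $p\in\mathbb{N}$. *)

(* Defs.v *)
From HB Require Import structures.
From mathcomp Require Export all_boot all_order all_algebra.
From mathcomp Require Export all_classical all_reals all_analysis.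
From mathcomp Require Export complex.

Set Implicit Arguments.
Unset Strict Implicit.
Unset Printing Implicit Defensive.

Import Order.TTheory GRing.Theory Num.Theory Num.Def.
Import numFieldNormedType.Exports.

Local Open Scope classical_set_scope.
Local Open Scope complex_scope.
Local Open Scope ring_scope.

(* Sequences are indexed from 0, so the sum of the first n terms of xi is
   \sum_(j < n) xi j. *)
Section Majorization.
Variable R : realType.
Implicit Types xi eta : nat -> R.

Definition majorized xi eta : Prop :=
  (forall n, \sum_(j < n) xi j <= \sum_(j < n) eta j) /\
  (\sum_(0 <= j <oo) (xi j)%:E = \sum_(0 <= j <oo) (eta j)%:E)%E.

Definition fin_pmajorized (p : nat) xi eta : Prop :=
  majorized xi eta /\
  exists N : nat, forall n, (N <= n)%N ->
    \sum_(j < n + p) xi j <= \sum_(j < n) eta j.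

(* An element p of {0, 1, 2, ...} \cup {oo} is an option nat, None being oo. *)
Definition pmajorized (p : option nat) xi eta : Prop :=
  if p is Some q then fin_pmajorized q xi eta
  else forall q, fin_pmajorized q xi eta.

Definition ereal_of_onat (p : option nat) : \bar R :=
  if p is Some q then q%:R%:E else +oo%E.

End Majorization.

Section Hilbert.
Variables (R : realType) (H : completeNormedModType R[i]).
Variable ip : {dot H for (@conjC R[i])}.

(* With this, the Banach space H is a Hilbert space with inner product ip;
   ip is linear in its first argument. *)
Definition hilbert_norm : Prop := forall x : H, `|x| ^+ 2 = ip x x.

Section Operators.
Implicit Types A T U P : {linear H -> H}.

Definition is_adjoint T (T' : {linear H -> H}) : Prop :=
  forall x y, ip (T x) y = ip x (T' y).

Definition positive_op A : Prop := forall x, 0 <= ip (A x) x.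

Definition compact_op A : Prop :=
  compact (closure (A @` [set x | `|x| <= 1])).

Definition compact_positive : set {linear H -> H} :=
  [set A : {linear H -> H} | [/\ continuous A, compact_op A & positive_op A]].

Definition unitary_with_adjoint U (U' : {linear H -> H}) : Prop :=
  [/\ continuous U, is_adjoint U U', cancel U U' & cancel U' U].

Definition unitary_orbit A : set {linear H -> H} :=
  [set X : {linear H -> H} | exists U U' : {linear H -> H},
    unitary_with_adjoint U U' /\ forall x, X x = U (A (U' x))].

Definition orthogonal_projection (M : set H) P : Prop :=
  [/\ forall x, P (P x) = P x, is_adjoint P P & range P = M].

Definition range_projection A P : Prop :=
  orthogonal_projection (closure (range A)) P.

Definition has_dim (V : set H) (n : nat) : Prop :=
  exists b : 'I_n -> H,
    (forall c : 'I_n -> R[i], \sum_i c i *: b i = 0 -> forall i, c i = 0) /\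
    V = [set x | exists c : 'I_n -> R[i], x = \sum_i c i *: b i].

Definition eigenspace_op A (lambda : R) : set H :=
  [set x | A x = lambda%:C *: x].

(* s = s(A) for a positive compact operator A: the decreasing enumeration, with
   multiplicity, of the nonzero eigenvalues of A. As s is nonincreasing and lists
   every positive eigenvalue, it vanishes somewhere only if A has finite rank,
   and then it vanishes exactly from the index rank A on. *)
Definition singular_values A (s : nat -> R) : Prop :=
  [/\ forall j, 0 <= s j,
      forall j k, (j <= k)%N -> s k <= s j &
      forall lambda : R, 0 < lambda -> exists n : nat,
        has_dim (eigenspace_op A lambda) n /\
        ([set j | s j = lambda] #= `I_n)%card].

End Operators.

Section Diagonal.
Variables (I : countType) (e : I -> H).
Implicit Types A X Y : {linear H -> H}.

Definition orthonormal_basis : Prop :=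
  (forall i j, ip (e i) (e j) = (i == j)%:R) /\
  closure [set x | exists (r : seq I) (c : I -> R[i]),
                     x = \sum_(i <- r) c i *: e i] = setT.

Definition diagonal_algebra : set {linear H -> H} :=
  [set T : {linear H -> H} | continuous T /\ forall i j, i != j -> ip (T (e i)) (e j) = 0].

(* The graph Y = E(X) of the conditional expectation: the two conditions
   determine Y. *)
Definition cond_exp X Y : Prop :=
  diagonal_algebra Y /\ forall i, ip (Y (e i)) (e i) = ip (X (e i)) (e i).

Definition cond_exp_unitary_orbit A : set {linear H -> H} :=
  [set Y : {linear H -> H} | exists2 X, unitary_orbit A X & cond_exp X Y].

(* Trace of a positive operator, in [0, +oo]. *)
Definition trace_pos (T : H -> H) : \bar R :=
  (\esum_(i in [set: I]) (complex.Re (ip (T (e i)) (e i)))%:E)%E.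

(* Tr P^perp, where P^perp = I - P. *)
Definition cotrace (P : {linear H -> H}) : \bar R :=
  trace_pos (fun x => x - P x).

End Diagonal.
End Hilbert.

(* Main.v *)
(* Since B is diagonal, it suffices to find an orthonormal basis (g_i) with
   <A g_i, g_i> = <B e_i, e_i> for all i; the unitary g_i |-> e_i then does the
   job. Let A be diagonal with eigenvalues eta in an orthonormal basis (f_j) and
   let xi be nonincreasing, with sum_(j<n) xi_j <= sum_(j<n) eta_j for all n.
   If b is the first index with eta_b <= xi_0, a rotation of f_(b-1), f_b
   produces g_0 with <A g_0, g_0> = xi_0 and a unit vector which, together with
   the remaining f_j, diagonalizes the compression of A to the complement of
   g_0; the partial sum inequalities persist, so that one can iterate. If x is
   orthogonal to g_0 then sum_j |<x, f_j>|^2 and sum_j eta_j |<x, f_j>|^2 over an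
   initial block are unchanged by the step. If the differences of the partial
   sums have lower limit 0, then the values eta left over from a suitable block
   become uniformly small, and x vanishes: the g_n form a basis. Two preparations
   are needed. First, p-majorization is what allows one to insert p zeros into
   the list eta (the part of ker A not matched with ker B) without destroying the
   inequalities. Second, if sum xi is infinite, the list eta is rearranged, using
   small eigenvalues early whenever the inequalities leave room for it, so that
   the lower limit becomes 0; if sum xi is finite it is 0 anyway. *)
From HB Require Import structures.
Require Import Defs.
From mathcomp Require Import ring lra zify.

Set Implicit Arguments.
Unset Strict Implicit.
Unset Printing Implicit Defensive.

Import Order.TTheory GRing.Theory Num.Theory Num.Def.
Import numFieldNormedType.Exports.

Local Open Scope classical_set_scope.
Local Open Scope complex_scope.
Local Open Scope ring_scope.

(** * Partial sums and defects *)

(** Since A is positive, <A g, g> = 0 forces A g = 0, so a zero diagonal entry of B can only be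
    served by a kernel vector of A. If B has infinite rank, a basis of ker A is therefore divided
    beforehand: one part is matched with the zero entries of B, and the rest must be absorbed, as
    zeros of the list eta, by strictly positive targets. If B has finite rank nothing is divided,
    and zero targets go through the same iteration.

    The obstacle is completeness. The iteration always yields orthonormal vectors with the right
    diagonal, but a vector orthogonal to all of them could survive, its mass being pushed to ever
    later indices; a defect bounded away from 0 leaves room for this. Hence the order of the list is
    settled before the first rotation. A lower limit 0 of the defects also ensures that an entry
    below the current target exists, so that every step can be made.

    Finite dimension, finite rank and the infinite case are treated alike: families are sequences
    over nat, and missing members are zero vectors marked as inactive. *)

Definition merge (T : Type) (b : nat) (h : T) (F : nat -> T) (j : nat) : T :=
  if (j < b)%N then F j else if j == b then h else F j.+1.

Lemma merge_lt T b h (F : nat -> T) j : (j < b)%N -> merge b h F j = F j.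
Proof. by rewrite /merge => ->. Qed.

Lemma merge_eq T b h (F : nat -> T) : merge b h F b = h.
Proof. by rewrite /merge ltnn eqxx. Qed.

Lemma merge_gt T b h (F : nat -> T) j : (b < j)%N -> merge b h F j = F j.+1.
Proof. by move=> bj; rewrite /merge ltnNge (ltnW bj) /= gtn_eqF. Qed.

Lemma sum_merge_le (V : zmodType) b h (F : nat -> V) m : (m <= b)%N ->
  \sum_(j < m) merge b h F j = \sum_(j < m) F j.
Proof.
by move=> mb; apply: eq_bigr => j _; rewrite merge_lt// (leq_trans (ltn_ord j)).
Qed.

Lemma sum_merge (V : zmodType) b h (F : nat -> V) m : (b < m)%N ->
  \sum_(j < m) merge b h F j = \sum_(j < m.+1) F j - F b - F b.+1 + h.
Proof.
elim: m => // m IH; rewrite ltnS leq_eqVlt => /predU1P[<-|bm].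
  rewrite big_ord_recr/= sum_merge_le// merge_eq.
  by rewrite !big_ord_recr/= [X in X - _]addrAC !addrK.
rewrite big_ord_recr/= IH// merge_gt//.
by rewrite [in RHS]big_ord_recr/= [LHS]addrAC; congr (_ + _); rewrite addrAC; congr (_ + _); rewrite addrAC.
Qed.

Section Scalar.
Variable R : realType.
Implicit Types E X x xi : nat -> R.

Definition defect E x (m : nat) : R := \sum_(j < m) E j - \sum_(j < m) x j.

Definition dominates E x := forall m, 0 <= defect E x m.

(** Together with [dominates]: the lower limit of the defects is 0. Asking for arbitrarily late [m]
    makes the property survive shifts and lets a block be enlarged at will. *)
Definition tight E x :=
  forall (eps : R) M, 0 < eps -> exists2 m, (M <= m)%N & defect E x m <= eps.

Definition tail x n : nat -> R := fun j => x (n + j)%N.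

Lemma sum_tailS x n m :
  \sum_(j < m) tail x n.+1 j = \sum_(j < m.+1) tail x n j - x n.
Proof.
rewrite [in RHS]big_ord_recl /tail addn0 addrC addKr.
by apply: eq_bigr => j _; rewrite addSnnS.
Qed.

Lemma defect_drop E x n m : E 0%N = x n ->
  defect (fun j => E j.+1) (tail x n.+1) m = defect E (tail x n) m.+1.
Proof. by move=> E0; rewrite /defect sum_tailS [X in _ = X - _]big_ord_recl/= E0; lra. Qed.

(** A step conserves the total of a block containing the merged pair: [x n] disappears from the
    partial sums of [E] and of the targets alike. *)
Lemma defect_merge E x n b m : (b < m)%N ->
  defect (merge b (E b + E b.+1 - x n) E) (tail x n.+1) m =
  defect E (tail x n) m.+1.
Proof. by move=> bm; rewrite /defect sum_tailS sum_merge//; ring. Qed.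

Lemma defectS E x m : defect E x m.+1 = defect E x m + (E m - x m).
Proof. by rewrite /defect !big_ord_recr/=; ring. Qed.

Lemma defectE E x m : defect E x m = \sum_(j < m) (E j - x j).
Proof. by rewrite sumrB. Qed.

Section Step.
Variables (E x : nat -> R) (n : nat).
Hypothesis xN : forall j k, (j <= k)%N -> x k <= x j.
Hypothesis domE : dominates E (tail x n).
Hypothesis tightE : tight E (tail x n).

(** If every entry exceeded [x n], all terms of the defect would be nonnegative, and the first one
    alone would keep it away from 0. *)
Lemma exists_le : exists b, E b <= x n.
Proof.
apply: contrapT => /forallNP H.
have {}H j : x n < E j by rewrite ltNge; apply/negP/H.
have e0 : 0 < (E 0%N - x n) / 2 by have := H 0%N; lra.
have [m m0 dm] := tightE 1 e0.
have : E 0%N - x n <= defect E (tail x n) m.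
  rewrite defectE; case: m m0 {dm} => // m _; rewrite big_ord_recl /tail addn0.
  rewrite lerDl; apply: sumr_ge0 => j _; rewrite subr_ge0.
  by apply: le_trans (ltW (H _)); apply: xN; rewrite leq_addr.
by have := H 0%N; lra.
Qed.

Lemma drop_eq : E 0%N <= x n -> E 0%N = x n.
Proof.
move=> E0; apply/eqP; rewrite eq_le E0/=.
by have := domE 1; rewrite defectE big_ord1 /tail addn0; lra.
Qed.

Lemma drop_dominates : E 0%N = x n ->
  dominates (fun j => E j.+1) (tail x n.+1).
Proof. by move=> E0 m; rewrite defect_drop. Qed.

Lemma drop_tight : E 0%N = x n -> tight (fun j => E j.+1) (tail x n.+1).
Proof.
move=> E0 e M e0; have [m mM dm] := tightE M.+1 e0.
by case: m mM dm => // m mM dm; exists m => //; rewrite defect_drop.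
Qed.

(** A block of length at most [b] consists of entries above [x n], hence above all later targets; a
    longer block has the defect it had before the step. *)
Lemma merge_dominates b : (forall j, (j <= b)%N -> x n < E j) ->
  dominates (merge b (E b + E b.+1 - x n) E) (tail x n.+1).
Proof.
move=> H m; have [mb|bm] := leqP m b; last by rewrite defect_merge.
rewrite defectE; apply: sumr_ge0 => j _.
rewrite merge_lt ?(leq_trans (ltn_ord j))// subr_ge0 /tail.
apply: (@le_trans _ _ (x n)); first by apply: xN; lia.
by apply/ltW/H; have := ltn_ord j; lia.
Qed.

Lemma merge_tight b : tight (merge b (E b + E b.+1 - x n) E) (tail x n.+1).
Proof.
move=> e M e0; have [m mM dm] := tightE (maxn M b.+1).+1 e0.
case: m mM dm => // m; rewrite ltnS geq_max => /andP[Mm bm] dm.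
by exists m => //; rewrite defect_merge.
Qed.

End Step.

(* Here E j = <A F_j, F_j> and X j = |<y, F_j>|^2, where y is orthogonal to the
   vector split off in the step. *)
Definition scalar_step (x : R) E X E' X' : Prop :=
  [/\ E 0%N = x, X 0%N = 0, E' = (fun j => E j.+1) & X' = (fun j => X j.+1)] \/
  exists b t, exists h : R,
    [/\ forall j, (j <= b)%N -> x < E j, E b.+1 <= x,
        x = t * E b + (1 - t) * E b.+1 & 
    [/\ X b = (1 - t) * h, X b.+1 = t * h,
        E' = merge b (E b + E b.+1 - x) E & X' = merge b h X]].

(** * Completeness of the vectors split off, in terms of squared coefficients *)

Section Completeness.
Variables (xi : nat -> R) (E X : nat -> nat -> R) (C : R).
Hypothesis xiN : forall j k, (j <= k)%N -> xi k <= xi j.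
Hypothesis xi_ge0 : forall j, 0 <= xi j.
Hypothesis xi0 : forall e : R, 0 < e -> exists j, xi j <= e.
Hypothesis domE : forall n, dominates (E n) (tail xi n).
Hypothesis tightE : forall n, tight (E n) (tail xi n).
Hypothesis E_ge0 : forall n j, 0 <= E n j.
Hypothesis X_ge0 : forall n j, 0 <= X n j.
Hypothesis XC : forall n m, \sum_(j < m) X n j <= C.
Hypothesis step : forall n, scalar_step (xi n) (E n) (X n) (E n.+1) (X n.+1).

(* A step inside the block preserves both sums; if there is none, then all
   entries of the block exceed xi n, by at most the defect. *)
Lemma block_bound m n : \sum_(j < m) E n j * X n j <=
  (2 * defect (E n) (tail xi n) m + xi (n + m).-1) * \sum_(j < m) X n j.
Proof.
elim: m n => [|m IH] n; first by rewrite !big_ord0 mulr0.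
case: (step n) => [[E0 X0 E' X']|[b [t [h [Eb Eb1 xE [Xb Xb1 E' X']]]]]].
  have := IH n.+1; rewrite E' X' defect_drop// addSnnS => H.
  by rewrite big_ord_recl [X in _ <= _ * X]big_ord_recl X0 mulr0 !add0r.
have [bm|mb] := ltnP b m.
  have := IH n.+1; rewrite E' X' defect_merge// addSnnS => H.
  suff -> : \sum_(j < m.+1) E n j * X n j =
     \sum_(j < m) merge b (E n b + E n b.+1 - xi n) (E n) j *
        merge b h (X n) j.
    suff -> : \sum_(j < m.+1) X n j = \sum_(j < m) merge b h (X n) j by [].
    by rewrite sum_merge// Xb Xb1; ring.
  (* As [xi n] is the mean of the pair with weights t and 1 - t, the mean with exchanged weights is
     [E n b + E n b.+1 - xi n], the merged entry. *)
  transitivity (\sum_(j < m) merge b ((E n b + E n b.+1 - xi n) * h)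
      (fun j => E n j * X n j) j).
    by rewrite sum_merge// Xb Xb1 xE; ring.
  by apply: eq_bigr => j _; rewrite /merge; case: ifP => // _; case: ifP.
rewrite mulr_sumr; apply: ler_sum => j _; apply: ler_wpM2r => //.
have Ex (i : 'I_m.+1) : 0 <= E n i - tail xi n i.
  rewrite subr_ge0 (@le_trans _ _ (xi n))//; first by apply: xiN; lia.
  by apply/ltW/Eb; have := ltn_ord i; lia.
have le1 (i : 'I_m.+1) : E n i - tail xi n i <= defect (E n) (tail xi n) m.+1.
  by rewrite defectE (bigD1 i)//= lerDl sumr_ge0.
(* The factor 2: one defect bounds [E n j - xi (n + j)], another bounds [xi (n + j) - xi (n + m)],
   because [xi (n + j) <= xi n < E n m]. *)
have := le1 j; have := le1 ord_max; rewrite /tail/=.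
have := Eb m mb; have : xi (n + j)%N <= xi n by rewrite xiN// leq_addr.
by rewrite addnS/=; lra.
Qed.

Lemma positive_vanish n i : 0 < E n i -> X n i = 0.
Proof.
move=> Ei; apply/eqP; rewrite eq_le X_ge0 andbT leNgt; apply/negP => Xi.
have C0 : 0 <= C by rewrite (le_trans _ (XC 0 0))// big_ord0.
(* Chosen so that the block bound, at most 3 e C once the defect and the last target are below e,
   falls short of the single term 4 e (C + 1). *)
pose e := E n i * X n i / (4 * (C + 1)).
have e0 : 0 < e by rewrite divr_gt0 ?mulr_gt0//; lra.
have [k xk] := xi0 e0.
have [m mM dm] := tightE n (maxn i k).+1 e0.
have [im km] : (i < m /\ k < m)%N by move: mM; rewrite gtn_max => /andP[].
have : E n i * X n i <= 3 * e * C.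
  rewrite (@le_trans _ _ (\sum_(j < m) E n j * X n j))//.
    rewrite (bigD1 (Ordinal im))//= lerDl sumr_ge0// => j _.
    exact: mulr_ge0.
  apply: (le_trans (block_bound m n)); apply: ler_pM => //.
  - by rewrite addr_ge0// mulr_ge0//; exact: domE.
  - exact: sumr_ge0.
  - have : xi (n + m).-1 <= xi k by apply: xiN; lia.
    by lra.
have -> : E n i * X n i = e * (4 * (C + 1)).
  by rewrite /e divfK// gt_eqF// mulr_gt0//; lra.
have := mulr_ge0 (ltW e0) C0; nra.
Qed.

(* An entry equal to 0 is eventually merged into a positive one. *)
Lemma zero_vanish n i : E n i = 0 -> X n i = 0.
Proof.
elim: i n => [|i IH] n Ei;
  case: (step n) => [[E0 X0 E' X']|[b [t [h [Eb Eb1 xE [Xb Xb1 E' X']]]]]] //.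
- by have := Eb 0%N (leq0n _); rewrite Ei ltNge xi_ge0.
- by have := IH n.+1; rewrite E' X'; exact.
- have [ib|] := leqP i.+1 b; first by have := Eb _ ib; rewrite Ei ltNge xi_ge0.
  rewrite ltnS leq_eqVlt => /predU1P[bi|bi].
    (* Merging with the zero entry [b.+1] leaves [E n b - xi n > 0], so the positive case gives h =
       0. *)
    have := @positive_vanish n.+1 b; rewrite E' X' !merge_eq => H.
    rewrite -bi Xb1 H ?mulr0// bi Ei -bi.
    by have := Eb b (leqnn b); lra.
  by have := IH n.+1; rewrite E' X' !merge_gt//; exact.
Qed.

Lemma vanish n i : X n i = 0.
Proof.
have := E_ge0 n i; rewrite le_eqVlt => /predU1P[/esym|]; first exact: zero_vanish.
exact: positive_vanish.
Qed.

End Completeness.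
End Scalar.

(** * Inner products and the rotation construction *)

Section Complex.
Variable R : realType.
Implicit Types (z w : R[i]) (a b : R).

(** The norm on [R[i]] is itself complex-valued; a real squared modulus is what the scalar part can
    use. *)
Definition nsq z : R := complex.Re z ^+ 2 + complex.Im z ^+ 2.

Lemma nsq_ge0 z : 0 <= nsq z. Proof. by rewrite addr_ge0 ?sqr_ge0. Qed.

Lemma nsqE z : (nsq z)%:C = z * z^*%C.
Proof. by rewrite /nsq add_Re2_Im2 sqr_normc. Qed.

Lemma nsq0 : nsq 0 = 0 :> R.
Proof. by rewrite /nsq /= expr0n/= addr0. Qed.

Lemma nsq_eq0 z : nsq z = 0 -> z = 0.
Proof.
move/eqP; rewrite /nsq paddr_eq0 ?sqr_ge0// !sqrf_eq0 => /andP[/eqP a /eqP b].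
by case: z a b => a b /= -> ->.
Qed.

Lemma nsqZ a z : nsq (a%:C * z) = a ^+ 2 * nsq z.
Proof. by case: z => x y; rewrite /nsq /=; ring. Qed.

Lemma nsq_conj z : nsq z^*%C = nsq z.
Proof. by case: z => x y; rewrite /nsq /=; ring. Qed.

Lemma real_complexM a b : (a * b)%:C = a%:C * b%:C.
Proof. by rewrite rmorphM. Qed.

Lemma real_complexD a b : (a + b)%:C = a%:C + b%:C.
Proof. by rewrite rmorphD. Qed.

Lemma real_complexB1 a : (1 - a)%:C = 1 - a%:C.
Proof. by rewrite rmorphB. Qed.

End Complex.

Section Inner.
Variables (R : realType) (H : completeNormedModType R[i]).
Variable ip : {dot H for (@conjC R[i])}.
Implicit Types (x y z : H) (F : nat -> H) (act : pred nat).

Lemma ipC x y : ip x y = (ip y x)^*%C.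
Proof. by rewrite (hermC ip) expr0 mul1r. Qed.

Lemma ipDl x y z : ip (x + y) z = ip x z + ip y z.
Proof. exact: linearDl. Qed.
Lemma ipDr x y z : ip z (x + y) = ip z x + ip z y.
Proof. exact: linearDr. Qed.
Lemma ipBl x y z : ip (x - y) z = ip x z - ip y z.
Proof. exact: linearBl. Qed.
Lemma ipBr x y z : ip z (x - y) = ip z x - ip z y.
Proof. exact: linearBr. Qed.
Lemma ipZl a x y : ip (a *: x) y = a * ip x y.
Proof. exact: linearZl_LR. Qed.
Lemma ipZr a x y : ip x (a *: y) = a^*%C * ip x y.
Proof. exact: linearZr_LR. Qed.
Lemma ipRr (a : R) x y : ip x (a%:C *: y) = a%:C * ip x y.
Proof. by rewrite ipZr conjc_real. Qed.
Lemma ip0l x : ip 0 x = 0. Proof. exact: linear0l. Qed.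
Lemma ip0r x : ip x 0 = 0. Proof. exact: linear0r. Qed.
Lemma ip_suml (I : Type) (r : seq I) P (f : I -> H) y :
  ip (\sum_(i <- r | P i) f i) y = \sum_(i <- r | P i) ip (f i) y.
Proof. exact: linear_sumlz. Qed.
Lemma ip_sumr (I : Type) (r : seq I) P (f : I -> H) y :
  ip y (\sum_(i <- r | P i) f i) = \sum_(i <- r | P i) ip y (f i).
Proof. exact: linear_sumr. Qed.

Lemma ip_eq0 x : ip x x = 0 -> x = 0.
Proof. by move/eqP; rewrite dnorm_eq0 => /eqP. Qed.

Lemma ip_eq0C x y : ip x y = 0 -> ip y x = 0.
Proof. by move=> h; rewrite ipC h conjc0. Qed.

Definition nrm2 x : R := complex.Re (ip x x).

Lemma nrm2E x : (nrm2 x)%:C = ip x x.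
Proof. by rewrite RRe_real// ger0_real// dnorm_ge0. Qed.

Lemma nrm2_ge0 x : 0 <= nrm2 x.
Proof. by rewrite -ler0c nrm2E dnorm_ge0. Qed.

(** An inactive index carries the zero vector, its square norm being 0; finite families thus become
    sequences. *)
Definition orthonormal_on act F :=
  forall i j, ip (F i) (F j) = ((i == j) && act j)%:R.

Lemma inactive0 act F j : orthonormal_on act F -> ~~ act j -> F j = 0.
Proof. by move=> oF aj; apply: ip_eq0; rewrite oF eqxx (negPf aj). Qed.

Lemma ip_proj act F x m k : orthonormal_on act F ->
  ip (\sum_(j < m) ip x (F j) *: F j) (F k) = if (k < m)%N then ip x (F k) else 0.
Proof.
move=> oF; rewrite ip_suml; case: ltnP => km.
  rewrite (bigD1 (Ordinal km))//= ipZl oF eqxx/= big1 ?addr0.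
    case: (boolP (act k)) => ak; first by rewrite mulr1.
    by rewrite mulr0 (inactive0 oF ak) ip0r.
  move=> j jk; rewrite ipZl oF [_ == _ :> nat](_ : _ = false) ?mulr0//.
  by apply: contraNF jk => /eqP jk; apply/eqP/val_inj.
rewrite big1// => j _; rewrite ipZl oF ltn_eqF ?mulr0//.
exact: leq_trans (ltn_ord j) km.
Qed.

Lemma nrm2_proj act F x m : orthonormal_on act F ->
  nrm2 (\sum_(j < m) ip x (F j) *: F j) = \sum_(j < m) nsq (ip x (F j)).
Proof.
move=> oF; apply: (@complexI R); rewrite nrm2E rmorph_sum/= ip_sumr.
apply: eq_bigr => j _.
by rewrite ipZr (ip_proj _ _ _ oF) ltn_ord nsqE mulrC.
Qed.

Lemma nrm2_sub_proj act F x m : orthonormal_on act F ->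
  nrm2 (x - \sum_(j < m) ip x (F j) *: F j) =
  nrm2 x - \sum_(j < m) nsq (ip x (F j)).
Proof.
move=> oF; rewrite -(nrm2_proj x m oF); set p := \sum_(j < m) _.
apply: (@complexI R); rewrite rmorphB/= !nrm2E ipBl !ipBr.
have E : ip x p = ip p p.
  rewrite {1 3}/p !ip_sumr; apply: eq_bigr => j _.
  by rewrite !ipZr (ip_proj _ _ _ oF) ltn_ord.
have E' : ip p x = ip p p by rewrite ipC E -ipC.
by rewrite E E' subrr subr0.
Qed.

Lemma bessel act F x m : orthonormal_on act F ->
  \sum_(j < m) nsq (ip x (F j)) <= nrm2 x.
Proof. by move=> oF; rewrite -subr_ge0 -(nrm2_sub_proj _ _ oF) nrm2_ge0. Qed.

End Inner.

(** * Splitting off vectors with prescribed values of the quadratic form *)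

Section Core.
Variables (R : realType) (H : completeNormedModType R[i]).
Variable ip : {dot H for (@conjC R[i])}.
Variable A : {linear H -> H}.
Variables (act : pred nat) (xi : nat -> R).
Hypothesis act_down : forall j k, (j <= k)%N -> act k -> act j.
Hypothesis xiN : forall j k, (j <= k)%N -> xi k <= xi j.
Hypothesis xi_ge0 : forall j, 0 <= xi j.
Hypothesis xi_act : forall j, ~~ act j -> xi j = 0.

(** Only the compression of [A] to the span is diagonal: a rotated vector is in general no
    eigenvector. *)
Definition diagonalizes (F : nat -> H) (E : nat -> R) :=
  forall i j, ip (A (F i)) (F j) = (E j)%:C * (i == j)%:R.

(** Each step consumes one active index and one target, whence the shift by [n] in [act] and
    [xi]. *)
Definition core_inv n (F : nat -> H) (E : nat -> R) :=
  [/\ orthonormal_on ip (fun j => act (n + j)%N) F, diagonalizes F E,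
      forall j, 0 <= E j, dominates E (tail xi n) & tight E (tail xi n)].

(** By the third clause the closed spans decrease, by the fourth [g] is orthogonal to what remains;
    iterated, they make the successive [g] pairwise orthogonal. The last clause feeds the
    completeness argument. *)
Definition core_step n F E (g : H) F' E' :=
  [/\ ip g g = (act n)%:R, ip (A g) g = (xi n)%:C,
   forall y, (forall j, ip y (F j) = 0) ->
     ip y g = 0 /\ forall j, ip y (F' j) = 0,
   forall j, ip g (F' j) = 0 &
   forall y, ip y g = 0 ->
     scalar_step (xi n) E (fun j => nsq (ip y (F j)))
       E' (fun j => nsq (ip y (F' j)))].

Lemma core_drop n F E : core_inv n F E -> E 0%N = xi n ->
  let F' := fun j => F j.+1 in let E' := fun j => E j.+1 in
  core_inv n.+1 F' E' /\ core_step n F E (F 0%N) F' E'.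
Proof.
move=> [oF dF E0 domE tE] Ex F' E'; split; split => //.
- by move=> i j; rewrite /F' oF eqSS addSnnS.
- by move=> i j; rewrite /F' dF eqSS.
- by move=> j; exact: E0.
- exact: (drop_dominates domE).
- exact: (drop_tight tE).
- by rewrite oF eqxx addn0.
- by rewrite dF eqxx mulr1 Ex.
- by move=> y yF; split=> [|j]; exact: yF.
- by move=> j; rewrite /F' oF.
- by move=> y yg; left; split=> //; rewrite yg nsq0.
Qed.

Lemma core_merge n F E b : core_inv n F E ->
  (forall j, (j <= b)%N -> xi n < E j) -> E b.+1 <= xi n -> act (n + b.+1)%N ->
  exists g F' E', core_inv n.+1 F' E' /\ core_step n F E g F' E'.
Proof.
move=> [oF dF E0 domE tE] Eb Eb1 actb.
have EE : E b.+1 < E b by apply: le_lt_trans Eb1 (Eb b _).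
(* The unit vector sqrt t F_b + sqrt (1 - t) F_(b+1) has quadratic form t E_b + (1 - t) E_(b+1);
   this is solved for the value [xi n]. *)
pose t := (xi n - E b.+1) / (E b - E b.+1).
have D0 : 0 < E b - E b.+1 by rewrite subr_gt0.
have xE : xi n = t * E b + (1 - t) * E b.+1.
  have : t * (E b - E b.+1) = xi n - E b.+1 by rewrite divfK// gt_eqF.
  by rewrite mulrBr mulrBl mul1r; lra.
have t0 : 0 <= t by rewrite divr_ge0// ?subr_ge0// ltW.
have t1 : 0 <= 1 - t.
  by rewrite subr_ge0 ler_pdivrMr// mul1r lerD2r ltW// Eb.
clearbody t; pose c := Num.sqrt t; pose s := Num.sqrt (1 - t).
have cE : c%:C * c%:C = t%:C by rewrite -real_complexM -expr2 sqr_sqrtr.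
have sE : s%:C * s%:C = (1 - t)%:C.
  by rewrite -real_complexM -expr2 sqr_sqrtr.
pose g := c%:C *: F b + s%:C *: F b.+1.
pose h := s%:C *: F b - c%:C *: F b.+1.
pose F' := merge b h F.
pose E' := merge b (E b + E b.+1 - xi n) E.
have actb' : act (n + b) by apply: act_down actb; lia.
have ng : (b.+1 == b) = false by rewrite gtn_eqF.
have ng' : (b == b.+1) = false by rewrite ltn_eqF.
have ipg y : ip y g = c%:C * ip y (F b) + s%:C * ip y (F b.+1).
  by rewrite ipDr !ipRr.
have iph y : ip y h = s%:C * ip y (F b) - c%:C * ip y (F b.+1).
  by rewrite ipBr !ipRr.
have ipg' y : ip g y = c%:C * ip (F b) y + s%:C * ip (F b.+1) y.
  by rewrite ipDl !ipZl.
have iph' y : ip h y = s%:C * ip (F b) y - c%:C * ip (F b.+1) y.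
  by rewrite ipBl !ipZl.
have AZ a x : A (a *: x) = a *: A x by exact: linearZ.
have Ag y : ip (A g) y = c%:C * ip (A (F b)) y + s%:C * ip (A (F b.+1)) y.
  by rewrite /g (linearD A) !AZ ipDl !ipZl.
have Ah y : ip (A h) y = s%:C * ip (A (F b)) y - c%:C * ip (A (F b.+1)) y.
  by rewrite /h (linearB A) !AZ ipBl !ipZl.
have hh : ip h h = 1.
  rewrite iph !iph' !oF !eqxx ng ng' actb actb' /= !mulr1 !mulr0 subr0 sub0r.
  by rewrite mulrN opprK sE cE real_complexB1 subrK.
have hgt j : (b < j)%N -> ip h (F j.+1) = 0.
  by move=> bj; rewrite iph' !oF !ltn_eqF ?mulr0 ?subr0//; clear -bj; lia.
have hlt j : (j < b)%N -> ip h (F j) = 0.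
  by move=> bj; rewrite iph' !oF !gtn_eqF ?mulr0 ?subr0//; clear -bj; lia.
have Ahgt j : (b < j)%N -> ip (A h) (F j.+1) = 0.
  by move=> bj; rewrite Ah !dF !ltn_eqF ?mulr0 ?subr0//; clear -bj; lia.
have Ahlt j : (j < b)%N -> ip (A h) (F j) = 0.
  by move=> bj; rewrite Ah !dF !gtn_eqF ?mulr0 ?subr0//; clear -bj; lia.
have Agt j : (b < j)%N -> ip (A (F j.+1)) h = 0.
  by move=> bj; rewrite iph !dF !gtn_eqF ?mulr0 ?subr0//; clear -bj; lia.
have Alt j : (j < b)%N -> ip (A (F j)) h = 0.
  by move=> bj; rewrite iph !dF !ltn_eqF ?mulr0 ?subr0//; clear -bj; lia.
have Ahh : ip (A h) h = (E b + E b.+1 - xi n)%:C.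
  rewrite Ah !iph !dF !eqxx ng ng' !mulr1 !mulr0 subr0 sub0r mulrN opprK.
  rewrite !mulrA sE cE -!real_complexM -real_complexD.
  by congr (_%:C); rewrite xE; ring.
exists g, F', E'; split; split.
- move=> i j; rewrite /F'; case: (ltngtP i b) => ib; case: (ltngtP j b) => jb.
  + by rewrite !merge_lt// oF addSn -addnS; case: eqVneq => // <-;
      rewrite (act_down _ actb') ?(act_down _ actb)//; clear -ib jb; lia.
  + by rewrite merge_lt// merge_gt// oF !ltn_eqF//; clear -ib jb; lia.
  + by rewrite jb merge_eq merge_lt// (ip_eq0C (hlt _ ib)) ltn_eqF.
  + by rewrite merge_gt// merge_lt// oF !gtn_eqF//; clear -ib jb; lia.
  + by rewrite !merge_gt// oF eqSS addSnnS.
  + by rewrite jb merge_eq merge_gt// (ip_eq0C (hgt _ ib)) gtn_eqF.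
  + by rewrite ib merge_eq merge_lt// hlt// gtn_eqF.
  + by rewrite ib merge_eq merge_gt// hgt// ltn_eqF.
  + by rewrite ib jb merge_eq hh eqxx addSnnS actb.
- move=> i j; rewrite /F' /E'; case: (ltngtP i b) => ib; case: (ltngtP j b) => jb.
  + by rewrite !merge_lt.
  + by rewrite merge_lt// !merge_gt// dF !ltn_eqF ?mulr0//; clear -ib jb; lia.
  + by rewrite jb !merge_eq merge_lt// Alt// ltn_eqF ?mulr0.
  + by rewrite merge_gt// !merge_lt// dF !gtn_eqF ?mulr0//; clear -ib jb; lia.
  + by rewrite !merge_gt// dF eqSS.
  + by rewrite jb !merge_eq merge_gt// Agt// gtn_eqF ?mulr0.
  + by rewrite ib merge_eq !merge_lt// Ahlt// gtn_eqF ?mulr0.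
  + by rewrite ib merge_eq !merge_gt// Ahgt// ltn_eqF ?mulr0.
  + by rewrite ib jb !merge_eq Ahh eqxx mulr1.
- move=> j; rewrite /E' /merge; case: ifP => // _; case: ifP => // _.
  by have := Eb b (leqnn b); have := E0 b.+1; lra.
- exact: (merge_dominates xiN domE).
- by apply: merge_tight.
- rewrite ipg !ipg' !oF !eqxx ng ng' actb actb' (act_down (leq_addr _ _) actb).
  by rewrite /= !mulr1 !mulr0 addr0 add0r sE cE real_complexB1 addrC subrK.
- rewrite ipg !Ag !dF !eqxx ng ng' !mulr1 !mulr0 addr0 add0r !mulrA.
  by rewrite cE sE xE -!real_complexM -real_complexD.
- move=> y yF; split=> [|j]; first by rewrite ipg !yF !mulr0 addr0.
  rewrite /F' /merge; case: ifP => // _; case: ifP => // _.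
  by rewrite iph !yF !mulr0 subr0.
- move=> j; rewrite /F'; case: (ltngtP j b) => jb.
  + by rewrite merge_lt// ipg' !oF !gtn_eqF ?mulr0 ?addr0//; clear -jb; lia.
  + by rewrite merge_gt// ipg' !oF !ltn_eqF ?mulr0 ?addr0//; clear -jb; lia.
  + rewrite jb merge_eq iph !ipg' !oF !eqxx ng ng' actb actb' /=.
    by rewrite !mulr1 !mulr0 addr0 add0r mulrC subrr.
- move=> y yg; right; exists b, t, (nsq (ip y h)).
  (* In the plane of F_b and F_(b+1), a vector orthogonal to [g] is a multiple of [h], with
     coordinates proportional to (s, -c). *)
  have e1 : ip y (F b) = s%:C * ip y h.
    rewrite iph mulrBr !mulrA sE [s%:C * _]mulrC -mulrA.
    have -> : s%:C * ip y (F b.+1) = - (c%:C * ip y (F b)).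
      by apply/eqP; rewrite -addr_eq0 addrC -ipg yg.
    by rewrite mulrN mulrA cE real_complexB1; ring.
  have e2 : ip y (F b.+1) = - c%:C * ip y h.
    rewrite iph mulNr mulrBr !mulrA cE [c%:C * s%:C]mulrC -mulrA.
    have -> : c%:C * ip y (F b) = - (s%:C * ip y (F b.+1)).
      by apply/eqP; rewrite -addr_eq0 -ipg yg.
    by rewrite mulrN mulrA sE real_complexB1; ring.
  split=> //; split=> //.
  + by rewrite e1 nsqZ sqr_sqrtr.
  + by rewrite e2 -rmorphN nsqZ sqrrN sqr_sqrtr.
  + by apply: boolp.funext => j; rewrite /F' /merge; case: ifP => // _; case: ifP.
Qed.

Lemma core_next n F E : core_inv n F E ->
  exists g F' E', core_inv n.+1 F' E' /\ core_step n F E g F' E'.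
Proof.
move=> inv; have [oF dF E0 domE tE] := inv.
have [b Eb minb] := ex_minnP (exists_le xiN tE).
case: b Eb minb => [|b] Eb minb.
  have {}Eb := drop_eq domE Eb.
  by have := core_drop inv Eb; exists (F 0%N), (fun j => F j.+1), (fun j => E j.+1).
have {minb}lt j : (j <= b)%N -> xi n < E j.
  by move=> jb; rewrite ltNge; apply: contraL jb => /minb; rewrite -ltnNge.
(* If [n + b.+1] were inactive, entries and targets would vanish beyond [b]. The defects would then
   be constant and at least [E b - xi n > 0], against tightness. *)
apply: (core_merge inv lt Eb); apply: contrapT => /negP nact.
have zero j : (b < j)%N -> E j = 0 /\ xi (n + j)%N = 0.
  move=> bj; have nj : ~~ act (n + j)%N.
    by apply: contraNN nact; apply: act_down; rewrite leq_add2l.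
  split; last exact: xi_act.
  apply: (@complexI R); rewrite -[RHS](ip0l ip (F j)) -(linear0 A).
  by rewrite -[X in A X](inactive0 oF nj) dF eqxx mulr1.
have cst m : (b < m)%N -> defect E (tail xi n) m = defect E (tail xi n) b.+1.
  elim: m => // m IH; rewrite ltnS leq_eqVlt => /predU1P[<-//|bm].
  by rewrite defectS IH// /tail; have [-> ->] := zero _ bm; rewrite subr0 addr0.
have e0 : 0 < (E b - xi n) / 2 by have := lt b (leqnn b); lra.
have [m bm] := tE _ b.+1 e0; rewrite cst// defectE big_ord_recr/= /tail.
have : 0 <= \sum_(j < b) (E j - xi (n + j)%N).
  apply: sumr_ge0 => j _; rewrite subr_ge0 (@le_trans _ _ (xi n))//.
    by apply: xiN; lia.
  by apply/ltW/lt; have := ltn_ord j; lia.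
have := lt b (leqnn b); have : xi (n + b)%N <= xi n by apply: xiN; lia.
lra.
Qed.

Hypothesis xi0 : forall e : R, 0 < e -> exists j, xi j <= e.

(** The last clause says that [g] and [f] have the same closed span, phrased through orthogonal
    complements. *)
Theorem core (f : nat -> H) (eta : nat -> R) :
  orthonormal_on ip act f -> diagonalizes f eta -> (forall j, 0 <= eta j) ->
  dominates eta xi -> tight eta xi ->
  exists g : nat -> H, [/\ orthonormal_on ip act g,
    forall n, ip (A (g n)) (g n) = (xi n)%:C &
    forall x, (forall n, ip x (g n) = 0) <-> (forall j, ip x (f j) = 0)].
Proof.
move=> of_ df eta0 dom tg.
(* States carry their invariant, so that a successor exists for every state and can be picked by
   choice. *)
pose S := {p : nat * (nat -> H) * (nat -> R) | core_inv p.1.1 p.1.2 p.2}.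
pose s0 : S := exist _ (0%N, f, eta) (And5 of_ df eta0 dom tg).
have nextP (s : S) : exists gs : H * S, (sval gs.2).1.1 = (sval s).1.1.+1 /\
    core_step (sval s).1.1 (sval s).1.2 (sval s).2 gs.1
      (sval gs.2).1.2 (sval gs.2).2.
  case: s => [[[n F] E] inv]/=; have [g [F' [E' [inv' st]]]] := core_next inv.
  by exists (g, exist _ (n.+1, F', E') inv').
have [nx nxP] := choice nextP.
pose st n := iter n (fun s => (nx s).2) s0.
have stn n : (sval (st n)).1.1 = n.
  by elim: n => // n IH; rewrite /st iterS (nxP _).1 IH.
pose F n := (sval (st n)).1.2; pose E n := (sval (st n)).2.
pose g n := (nx (st n)).1.
have inv n : core_inv n (F n) (E n) by have := svalP (st n); rewrite stn.
have stepP n : core_step n (F n) (E n) (g n) (F n.+1) (E n.+1).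
  by have := (nxP (st n)).2; rewrite stn.
have perpF x k : (forall j, ip x (F k j) = 0) ->
    forall d, (forall j, ip x (F (k + d)%N j) = 0) /\ ip x (g (k + d)%N) = 0.
  move=> xF d; elim: d => [|d [IH _]].
    by rewrite addn0; have [_ _ /(_ x xF)[]] := stepP k.
  rewrite addnS; have [_ _ /(_ x IH)[_ h] _ _] := stepP (k + d)%N.
  by split=> //; have [_ _ /(_ x h)[]] := stepP (k + d).+1.
have perp i j : (i < j)%N -> ip (g i) (g j) = 0.
  move=> ij; have [_ _ _ h _] := stepP i.
  by have := (perpF _ _ h (j - i.+1)%N).2; rewrite subnKC.
exists g; split.
- move=> i j; case: (ltngtP i j) => [ij|ji|<-].
  + exact: perp.
  + exact/ip_eq0C/perp.
  + by have [] := stepP i.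
- by move=> n; have [] := stepP n.
move=> x; split=> [xg j|xf n]; last exact: (perpF x 0%N xf n).2.
pose X n j := nsq (ip x (F n j)).
apply: nsq_eq0; apply: (@vanish _ xi E X (nrm2 ip x) _ _ _ _ _ _ _ _ _ 0%N j) => //.
- by move=> n; have [] := inv n.
- by move=> n; have [] := inv n.
- by move=> n; have [] := inv n.
- by move=> n i; exact: nsq_ge0.
- by move=> n m; have [oF _ _ _ _] := inv n; exact: (bessel _ _ oF).
- by move=> n; have [_ _ _ _ /(_ x (xg n))] := stepP n.
Qed.

End Core.

(** * Rearranging the eigenvalues *)

Section Approx.
Variable R : realType.
Implicit Types E xi eta : nat -> R.

Lemma psum_le xi m n : (forall j, 0 <= xi j) -> (m <= n)%N ->
  \sum_(j < m) xi j <= \sum_(j < n) xi j.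
Proof.
move=> xi0 mn; rewrite -!(big_mkord xpredT xi) (big_cat_nat (leq0n m) mn)/=.
by rewrite lerDl sumr_ge0.
Qed.

Lemma psum_stable xi m n : (forall j, (m <= j)%N -> xi j = 0) -> (m <= n)%N ->
  \sum_(j < n) xi j = \sum_(j < m) xi j.
Proof.
move=> xi0; elim: n => [|n IH]; first by rewrite leqn0 => /eqP ->.
rewrite leq_eqVlt => /predU1P[->//|]; rewrite ltnS => mn.
by rewrite big_ord_recr/= IH// xi0// addr0.
Qed.

(** The half of the equality of infinite sums that domination does not give, in a form that also
    makes sense when both sums are infinite. *)
Definition cofinal eta xi := forall n (e : R), 0 < e ->
  exists m, \sum_(j < n) eta j <= \sum_(j < m) xi j + e.

Lemma majorized_cofinal xi eta : (forall j, 0 <= xi j) -> (forall j, 0 <= eta j) ->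
  majorized xi eta -> cofinal eta xi.
Proof.
move=> xi0 eta0 [_ eqs] n e e0; apply: contrapT => /forallNP H.
have {}H m : \sum_(j < m) xi j <= \sum_(j < n) eta j - e.
  by have /negP := H m; rewrite -ltNge; lra.
have h1 : ((\sum_(j < n) eta j)%:E <= \sum_(0 <= j <oo) (eta j)%:E)%E.
  rewrite -(big_mkord xpredT eta) -sumEFin; apply: nneseries_lim_ge => j _ _.
  by rewrite lee_fin.
have h2 : (\sum_(0 <= j <oo) (xi j)%:E <= (\sum_(j < n) eta j - e)%:E)%E.
  apply: lime_le; first by apply: is_cvg_nneseries => j _ _; rewrite lee_fin.
  by apply: nearW => m; rewrite sumEFin lee_fin big_mkord.
by move: h1; rewrite -eqs => /le_trans/(_ h2); rewrite lee_fin; lra.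
Qed.

Lemma psum_cauchy xi C (e : R) : (forall j, 0 <= xi j) ->
  (forall n, \sum_(j < n) xi j <= C) -> 0 < e ->
  exists N, forall n, \sum_(j < n) xi j < \sum_(j < N) xi j + e.
Proof.
move=> xi0 bC e0; pose S := [set \sum_(j < n) xi j | n in setT].
have supS : has_sup S.
  split; first by exists (\sum_(j < 0) xi j); exists 0%N.
  by exists C => _ [n _ <-].
have [_ [n _ <-] hn] := sup_adherent e0 supS.
exists n => m; have : \sum_(j < m) xi j <= sup S.
  by apply: ub_le_sup; [exact: supS.2 | exists m].
lra.
Qed.

(** Late partial sums of [xi] are within e/2 of all larger ones, and by cofinality those of [E]
    exceed some partial sum of [xi] by at most e/2. *)
Lemma tight_bounded E xi C : (forall j, 0 <= xi j) -> cofinal E xi ->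
  (forall n, \sum_(j < n) xi j <= C) -> tight E xi.
Proof.
move=> xi0 cof bC e M e0; have e2 : 0 < e / 2 by lra.
have [n hn] := psum_cauchy xi0 bC e2.
exists (maxn M n); first exact: leq_maxl.
have [m hm] := cof (maxn M n) (e / 2) e2.
have := hn m; have := psum_le xi0 (leq_maxr M n); rewrite /defect; lra.
Qed.

Lemma tight_finite eta xi N : (forall j, 0 <= xi j) -> cofinal eta xi ->
  (forall j, (N <= j)%N -> eta j = 0) -> tight eta xi.
Proof.
move=> xi0 cof etaN e M e0; have [m hm] := cof N e e0.
exists (maxn N (maxn m M)); first lia.
rewrite /defect (psum_stable etaN) ?leq_maxl//.
have mm : (m <= maxn N (maxn m M))%N by lia.
have := psum_le xi0 mm; lra.
Qed.

End Approx.

Section Rearrange.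
Variables (R : realType) (E xi : nat -> R).
Hypothesis xiN : forall j k, (j <= k)%N -> xi k <= xi j.
Hypothesis xi_ge0 : forall j, 0 <= xi j.
Hypothesis xi0 : forall e : R, 0 < e -> exists j, xi j <= e.
Hypothesis E0 : forall (e : R) n, 0 < e -> exists2 m, (n <= m)%N & E m <= e.
Hypothesis E_ge0 : forall j, 0 <= E j.
Hypothesis domE : dominates E xi.
Hypothesis unbounded : forall C, exists n, C < \sum_(j < n) xi j.

Let xi_gt0 j : 0 < xi j.
Proof.
rewrite lt_neqAle xi_ge0 andbT; apply/eqP => xj.
have [n] := unbounded (\sum_(i < j) xi i); apply/negP; rewrite -leNgt.
rewrite -(@psum_stable _ xi j (maxn j n)) ?psum_le ?leq_maxl ?leq_maxr// => k jk.
by apply/eqP; rewrite eq_le xi_ge0 andbT xj xiN.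
Qed.

(* L enumerates the indices not yet used and d is the present defect; the
   surplus is the defect after l more terms in the order of L. *)
Definition surplus (L : nat -> nat) d m l :=
  d + defect (fun j => E (L j)) (tail xi m) l.

(* If loose, any entry of L can be moved to the front. If not, the surplus drops
   below some xi (m + l), hence so does d after l steps at the front of L. *)
Definition loose L d m := forall l, xi (m + l)%N <= surplus L d m l.

(** While loose, the removed entry is at most [xi m / 2], so the defect loses at least [xi m / 2];
    as the sum of [xi] diverges, this cannot go on forever. Taking the front entry otherwise ensures
    that every index gets used. *)
Definition removal L d m : nat :=
  xget 0%N [set p | (loose L d m -> E (L p) <= xi m / 2) /\
                    (~ loose L d m -> p = 0%N)].

Fixpoint greedy n : (nat -> nat) * R :=
  if n is m.+1 then
    let: (L, d) := greedy m in let p := removal L d m in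
    (fun l => L (bump p l), d + E (L p) - xi m)
  else (id, 0).

Let L n := (greedy n).1.
Let d n := (greedy n).2.
Let p n := removal (L n) (d n) n.
Let sigma n := L n (p n).

Let LS n : L n.+1 = fun l => L n (bump (p n) l).
Proof. by rewrite /p /L /d /=; case: (greedy n). Qed.

Let dS n : d n.+1 = d n + E (sigma n) - xi n.
Proof. by rewrite /sigma /p /L /d /=; case: (greedy n). Qed.

Lemma sum_bump (F : nat -> R) q l : (q <= l)%N ->
  \sum_(j < l) F (bump q j) = \sum_(j < l.+1) F j - F q.
Proof.
elim: l => [|l IH].
  by rewrite leqn0 => /eqP ->; rewrite big_ord0 big_ord1 subrr.
rewrite leq_eqVlt => /predU1P[->|].
  rewrite [in RHS]big_ord_recr/= addrK.
  by apply: eq_bigr => j _; rewrite /bump leqNgt ltn_ord.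
rewrite ltnS => ql; rewrite big_ord_recr/= IH// [in RHS]big_ord_recr/=.
by rewrite /bump ql add1n; ring.
Qed.

Lemma sum_bump_lt (F : nat -> R) q l : (l <= q)%N ->
  \sum_(j < l) F (bump q j) = \sum_(j < l) F j.
Proof.
move=> lq; apply: eq_bigr => j _.
by rewrite /bump leqNgt (leq_trans (ltn_ord j) lq).
Qed.

Let surplus_ge n l : (p n <= l)%N ->
  surplus (L n.+1) (d n.+1) n.+1 l = surplus (L n) (d n) n l.+1.
Proof.
move=> pl; rewrite /surplus /defect dS LS sum_tailS.
by rewrite (sum_bump (fun j => E (L n j)))// /sigma; ring.
Qed.

(** The removed entry comes from outside the first [l], while one more target is charged; looseness
    says exactly that the old surplus can pay for it. *)
Let surplus_lt n l : (l <= p n)%N ->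
  surplus (L n.+1) (d n.+1) n.+1 l =
  surplus (L n) (d n) n l + E (sigma n) - xi (n + l)%N.
Proof.
move=> pl; rewrite /surplus /defect dS LS sum_tailS.
rewrite (sum_bump_lt (fun j => E (L n j)))// big_ord_recr/= /tail; ring.
Qed.

Let small n (e : R) l : 0 < e -> exists2 m, (l <= m)%N & E (L n m) <= e.
Proof.
elim: n e l => [|n IH] e l e0; first exact: E0.
have [m lm Em] := IH e (maxn l (p n)).+1 e0.
exists m.-1; first lia.
by rewrite LS /bump (_ : (_ <= _)%N = true) ?add1n ?prednK//; lia.
Qed.

Let pP n : (loose (L n) (d n) n -> E (sigma n) <= xi n / 2) /\
           (~ loose (L n) (d n) n -> p n = 0%N).
Proof.
rewrite /sigma /p /removal; case: xgetP => [q _ [] //|H]; exfalso.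
have [lo|nlo] := pselect (loose (L n) (d n) n); last by apply: (H 0%N).
have x2 : 0 < xi n / 2 by have := xi_gt0 n; lra.
have [m _ Em] := small n 0%N x2.
by apply: (H m).
Qed.

Let surplus_ge0 n l : 0 <= surplus (L n) (d n) n l.
Proof.
elim: n l => [|n IH] l; first by rewrite /surplus add0r; exact: domE.
have [pl|lp] := leqP (p n) l; first by rewrite surplus_ge.
rewrite surplus_lt ?(ltnW lp)//.
have [lo|nlo] := pselect (loose (L n) (d n) n).
  by have := lo l; have := E_ge0 (sigma n); lra.
by move: lp; rewrite (pP n).2.
Qed.

Let dE n : d n = defect (E \o sigma) xi n.
Proof.
elim: n => [|n IH]; first by rewrite /defect !big_ord0 subrr.
by rewrite dS defectS -IH/=; ring.
Qed.

Let surplus0 n : surplus (L n) (d n) n 0 = d n.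
Proof. by rewrite /surplus /defect !big_ord0 subrr addr0. Qed.

Let tight_often n : exists2 m, (n <= m)%N & ~ loose (L m) (d m) m.
Proof.
apply: contrapT => H.
have lo m : (n <= m)%N -> loose (L m) (d m) m.
  by move=> nm; apply: contrapT => nlo; apply: H; exists m.
have dk k : d (n + k)%N <= d n - (\sum_(j < n + k) xi j - \sum_(j < n) xi j) / 2.
  elim: k => [|k IH]; first by rewrite addn0; lra.
  rewrite addnS dS big_ord_recr/=.
  by have := (pP (n + k)).1 (lo _ (leq_addr _ _)); lra.
have [m Hm] := unbounded (\sum_(j < n) xi j + 2 * d n).
have := dk m; have := surplus_ge0 (n + m) 0; rewrite surplus0.
have := psum_le xi_ge0 (leq_addl n m); lra.
Qed.

Let small_often n : exists2 m, (n <= m)%N & d m < xi m.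
Proof.
have [m nm /existsNP[l /negP]] := tight_often n; rewrite -ltNge.
elim: l m nm => [|l IH] m nm; first by rewrite addn0 surplus0; exists m.
move=> H; have pm : p m = 0%N.
  by apply: (pP m).2 => /(_ l.+1); rewrite leNgt H.
by apply: (IH m.+1); [lia | rewrite surplus_ge ?pm// addSnnS].
Qed.

Let L_inj n : injective (L n).
Proof.
elim: n => [|n IH]; first by move=> i j.
by rewrite LS => i j /IH; apply: (can_inj (bumpK _)).
Qed.

Let L_sub n k l : exists q, L (n + k) l = L n q.
Proof.
elim: k l => [|k IH] l; first by exists l; rewrite addn0.
by rewrite addnS LS; exact: IH.
Qed.

Let sigma_inj : injective sigma.
Proof.
have H m n : (m < n)%N -> sigma m <> sigma n.
  move=> mn; have [q] := L_sub m.+1 (n - m.+1) (p n).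
  rewrite subnKC// /sigma => ->; rewrite LS => /L_inj /eqP.
  by rewrite (negPf (neq_bump _ _)).
move=> m n mn; case: (ltngtP m n) => // /H; first by rewrite mn.
by rewrite mn.
Qed.

Let sigma_surj n q : exists m, sigma m = L n q.
Proof.
elim/ltn_ind: q n => q IHq n.
have track t : (exists m, sigma m = L n q) \/
    exists2 q', (q' <= q)%N & L (n + t) q' = L n q.
  elim: t => [|t [?|[q' q'q Lq']]]; [by right; exists q; rewrite ?addn0 | by left |].
  have [pq|pq] := eqVneq q' (p (n + t)%N).
    by left; exists (n + t)%N; rewrite /sigma -pq.
  right; exists (unbump (p (n + t)) q'); last by rewrite addnS LS unbumpK.
  by rewrite (leq_trans _ q'q)// /unbump leq_subr.
have [m nm nlo] := tight_often n.
have [//|[q' q'q]] := track (m - n)%N; rewrite subnKC// => <-.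
have pm := (pP m).2 nlo.
case: q' q'q => [|q'] q'q; first by exists m; rewrite /sigma pm.
by have [k sk] := IHq q' q'q m.+1; exists k; rewrite sk LS pm.
Qed.

Theorem rearrange : exists s : nat -> nat,
  [/\ injective s, forall j, exists n, s n = j, dominates (E \o s) xi &
      tight (E \o s) xi].
Proof.
exists sigma; split=> //.
- by move=> j; exact: (sigma_surj 0 j).
- by move=> n; rewrite -dE -surplus0.
move=> e M e0; have [j xj] := xi0 e0.
have [m jm dm] := small_often (maxn j M).
exists m; first lia.
by rewrite -dE (le_trans (ltW dm))// (le_trans _ xj)// xiN//; lia.
Qed.

End Rearrange.

(** * Inserting the zero eigenvalues *)

(* Initial segments of nat, None standing for nat itself. *)
Definition below (k : option nat) (n : nat) : bool :=
  if k is Some q then (n < q)%N else true.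

Lemma below_le k m n : (m <= n)%N -> below k n -> below k m.
Proof. by case: k => //= k; exact: leq_ltn_trans. Qed.

Section Interleave.
Variables (R : realType) (eta xi : nat -> R) (K : option nat).
Hypothesis etaN : forall j k, (j <= k)%N -> eta k <= eta j.
Hypothesis eta0 : forall e : R, 0 < e -> exists j, eta j <= e.
Hypothesis eta_gt0 : forall j, 0 < eta j.
Hypothesis xi_ge0 : forall j, 0 <= xi j.
Hypothesis cof : cofinal eta xi.
Hypothesis dom : dominates eta xi.
Hypothesis pdom : forall k, below K k -> exists N, forall n, (N <= n)%N ->
  \sum_(j < n + k.+1) xi j <= \sum_(j < n) eta j.

(* i entries of eta and k zeros have been placed, and another zero fits. *)
Definition room i k : bool :=
  below K k && `[< forall l, (i <= l)%N ->
    \sum_(j < l + k.+1) xi j <= \sum_(j < l) eta j >].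

Fixpoint count n : nat * nat :=
  if n is m.+1 then
    let: (i, k) := count m in if room i k then (i, k.+1) else (i.+1, k)
  else (0%N, 0%N).

Let i n := (count n).1.
Let k n := (count n).2.
Let c n := room (i n) (k n).

Let iS n : i n.+1 = if c n then i n else (i n).+1.
Proof. by rewrite /c /i /k /=; case: (count n) => a b /=; case: ifP. Qed.

Let kS n : k n.+1 = if c n then (k n).+1 else k n.
Proof. by rewrite /c /i /k /=; case: (count n) => a b /=; case: ifP. Qed.

Let ik n : (i n + k n)%N = n.
Proof. by elim: n => // n IH; rewrite iS kS; case: (c n); lia. Qed.

Let i_mono m n : (m <= n)%N -> (i m <= i n)%N.
Proof.
elim: n => [|n IH]; first by rewrite leqn0 => /eqP ->.
by rewrite leq_eqVlt => /predU1P[->//|/IH H]; rewrite iS; case: (c n); lia.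
Qed.

Let k_mono m n : (m <= n)%N -> (k m <= k n)%N.
Proof.
elim: n => [|n IH]; first by rewrite leqn0 => /eqP ->.
by rewrite leq_eqVlt => /predU1P[->//|/IH H]; rewrite kS; case: (c n); lia.
Qed.

(** Demanding the bound for all later [l] keeps it possible to continue with entries of [eta]
    alone. *)
Let inv n l : (i n <= l)%N -> \sum_(j < l + k n) xi j <= \sum_(j < l) eta j.
Proof.
elim: n l => [|n IH] l; first by rewrite addn0 -subr_ge0 => _; exact: dom.
rewrite iS kS; case: ifP => [/andP[_ /asboolP H]|_]; first exact: H.
by move=> il; apply: IH; lia.
Qed.

Let below_k n : c n -> below K (k n). Proof. by case/andP. Qed.

(** If only zeros were placed from [n] on, every partial sum of [xi] would stay below the sum of the
    first [i n] entries of [eta]; by cofinality they come close to the sum of one more entry, which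
    is positive. *)
Let i_often n : exists2 m, (n <= m)%N & ~~ c m.
Proof.
apply: contrapT => H.
have cm m : (n <= m)%N -> c m.
  by move=> nm; apply: contrapT => /negP cm; apply: H; exists m.
have ikm m : i (n + m)%N = i n /\ k (n + m)%N = (k n + m)%N.
  elim: m => [|m [IHi IHk]]; first by rewrite !addn0.
  by rewrite addnS iS kS cm ?leq_addr// IHi IHk addnS.
have e2 : 0 < eta (i n) / 2 by have := eta_gt0 (i n); lra.
have [m hm] := cof (i n).+1 e2.
have := @inv (n + m) (i n); rewrite (ikm m).1 (ikm m).2 => /(_ (leqnn _)).
have mm : (m <= i n + (k n + m))%N by lia.
have := psum_le xi_ge0 mm; move: hm; rewrite big_ord_recr/=.
by have := eta_gt0 (i n); lra.
Qed.

Let i_unbounded a : exists n, (a <= i n)%N.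
Proof.
elim: a => [|a [n an]]; first by exists 0%N.
have [m nm cm] := i_often n; exists m.+1.
by rewrite iS (negPf cm); have := i_mono nm; lia.
Qed.

(** If the count of zeros got stuck at [a] or before, [pdom] would provide room for another zero as
    soon as enough entries of [eta] have been placed. *)
Let k_unbounded a : below K a -> exists n, (a < k n)%N.
Proof.
elim: a => [|a IH] Ka.
- apply: contrapT => /forallNP H.
  have k0 n : k n = 0%N by apply/eqP; rewrite -leqn0 leqNgt; apply/negP/H.
  have [N HN] := pdom Ka; have [n Nn] := i_unbounded N.
  have : c n.
    apply/andP; rewrite k0; split=> //; apply/asboolP => l il.
    by apply: HN; lia.
  by have := k0 n.+1; rewrite kS => + cn; rewrite cn.
- have [n0 an0] := IH (below_le (leqnSn a) Ka).
  apply: contrapT => /forallNP H.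
  have kn n : (n0 <= n)%N -> k n = a.+1.
    move=> nn; apply/eqP; rewrite eqn_leq.
    by have := H n; have := k_mono nn; lia.
  have [N HN] := pdom Ka; have [n Nn] := i_unbounded N.
  pose m := maxn n n0.
  have : c m.
    apply/andP; rewrite kn ?leq_maxr//; split=> //; apply/asboolP => l il.
    by apply: HN; have := i_mono (leq_maxl n n0); rewrite -/m; lia.
  have := kn m.+1; rewrite kS kn ?leq_maxr// => + cm; rewrite cm => H1.
  have /H1 : (n0 <= m.+1)%N by rewrite /m; lia.
  lia.
Qed.

Let hit (P : pred nat) (u : nat -> nat) a : u 0%N = 0%N ->
  (forall n, u n.+1 = if P n then (u n).+1 else u n) ->
  (exists n, (a < u n)%N) -> exists2 n, P n & u n = a.
Proof.
move=> u0 uS exu; have [n au min] := ex_minnP exu.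
case: n au min => [|n]; first by rewrite u0.
rewrite uS => au min; exists n.
  case: (P n) au => // /min; lia.
by case: (P n) au => au; [have := min n; lia | have := min n au; lia].
Qed.

(** [inl a] stands for the eigenvalue [eta a] and [inr a] for the zero with number [a]; [tau] is a
    bijection onto the eigenvalues and the zeros below [K]. *)
Theorem interleave : exists tau : nat -> nat + nat,
  [/\ injective tau, forall a, exists n, tau n = inl a,
      forall a, (exists n, tau n = inr a) <-> below K a &
      let E n := if tau n is inl a then eta a else 0 in
      [/\ dominates E xi, cofinal E xi &
        forall (e : R) n, 0 < e -> exists2 m, (n <= m)%N & E m <= e]].
Proof.
pose tau n : nat + nat := if c n then inr (k n) else inl (i n).
have sumE n : \sum_(j < n) (if tau j is inl a then eta a else 0) =
    \sum_(j < i n) eta j.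
  elim: n => [|n IH]; first by rewrite !big_ord0.
  rewrite big_ord_recr/= IH iS /tau; case: (c n); first by rewrite addr0.
  by rewrite big_ord_recr.
exists tau; split.
- have H m n : (m < n)%N -> tau m <> tau n.
    move=> mn; have := i_mono mn; have := k_mono mn; rewrite iS kS /tau.
    by case: (c m); case: (c n) => // + + [] ; lia.
  move=> m n mn; case: (ltngtP m n) => // /H; first by rewrite mn.
  by rewrite mn.
- move=> a; have [|||n /= cn ia] := @hit (predC c) i a.
  + by [].
  + by move=> n; rewrite iS /=; case: (c n).
  + have [n an] := i_unbounded a.+1; by exists n.
  by exists n; rewrite /tau (negPf cn) ia.
- move=> a; split=> [[n]|Ka].
    by rewrite /tau; case: ifP => // cn [<-]; exact: below_k.
  have [|n cn ka] := @hit c k a erefl kS; first exact: k_unbounded.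
  by exists n; rewrite /tau cn ka.
split.
- move=> n; rewrite /defect sumE subr_ge0 -[in X in X <= _](ik n).
  exact: inv.
- by move=> n e e0; rewrite sumE; exact: cof.
- move=> e n e0; have [j ej] := eta0 e0.
  have [m jm] := i_unbounded j; exists (maxn n m); first exact: leq_maxl.
  rewrite /tau; case: (c _); first exact: ltW.
  apply: le_trans ej; apply: etaN.
  by rewrite (leq_trans jm)// i_mono// leq_maxr.
Qed.

Hypothesis xiN : forall j k, (j <= k)%N -> xi k <= xi j.
Hypothesis xi0 : forall e : R, 0 < e -> exists j, xi j <= e.

Theorem arrangement : exists tau : nat -> nat + nat,
  [/\ injective tau, forall a, exists n, tau n = inl a,
      forall a, (exists n, tau n = inr a) <-> below K a &
      let E n := if tau n is inl a then eta a else 0 in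
      dominates E xi /\ tight E xi].
Proof.
have [tau [tau_inj tau_l tau_r /= [domE cofE smallE]]] := interleave.
set E := (fun n => _) in domE cofE smallE.
have E_ge0 j : 0 <= E j by rewrite /E; case: (tau j) => // a; exact: ltW.
have [[C bC]|unb] := pselect (exists C, forall n, \sum_(j < n) xi j <= C).
  exists tau; split=> //; split=> //.
  exact: (tight_bounded xi_ge0 cofE bC).
have {}unb C : exists n, C < \sum_(j < n) xi j.
  apply: contrapT => /forallNP H; apply: unb; exists C => n.
  by rewrite leNgt; apply/negP/H.
have [s [s_inj s_surj domEs tEs]] :=
  rearrange xiN xi_ge0 xi0 smallE E_ge0 domE unb.
exists (tau \o s); split=> //.
- exact: inj_comp.
- move=> a; have [n tn] := tau_l a; have [m sm] := s_surj n.
  by exists m; rewrite /= sm.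
- move=> a; split=> [[n tn]|/tau_r[n tn]]; first by apply/tau_r; exists (s n).
  by have [m sm] := s_surj n; exists m; rewrite /= sm.
Qed.

End Interleave.

(** * Topology of the Hilbert space *)

Section Topology.
Variables (R : realType) (H : completeNormedModType R[i]).
Variable ip : {dot H for (@conjC R[i])}.
Hypothesis hip : hilbert_norm ip.
Implicit Types (x y z : H) (A : {linear H -> H}).
Local Notation nrm2 := (nrm2 ip).

Lemma norm_nrm2 x : `|x| ^+ 2 = (nrm2 x)%:C.
Proof. by rewrite nrm2E hip. Qed.

Lemma norm_le x (e : R) : 0 <= e -> (`|x| <= e%:C) = (nrm2 x <= e ^+ 2).
Proof.
move=> e0; rewrite -lecR -norm_nrm2 (rmorphXn (real_complex R)).
by rewrite ler_pXn2r// nnegrE ?ler0c.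
Qed.

Lemma norm_lt x (e : R) : 0 <= e -> (`|x| < e%:C) = (nrm2 x < e ^+ 2).
Proof.
move=> e0; rewrite -ltcR -norm_nrm2 (rmorphXn (real_complex R)).
by rewrite ltr_pXn2r// nnegrE ?ler0c.
Qed.

Lemma norm_lt_sqrt x (e : R) : 0 < e -> (`|x| < (Num.sqrt e)%:C) = (nrm2 x < e).
Proof. by move=> e0; rewrite norm_lt ?sqrtr_ge0// sqr_sqrtr// ltW. Qed.

Lemma pos_complexP (e : R[i]) : 0 < e -> exists2 r : R, 0 < r & e = r%:C.
Proof.
case: e => a b; rewrite ltcE /= => /andP[/eqP b0 a0].
by exists a => //; rewrite b0 complexr0.
Qed.

Lemma sqrt_pos (e : R) : 0 < e -> 0 < (Num.sqrt e)%:C.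
Proof. by move=> e0; rewrite ltcR sqrtr_gt0. Qed.

Lemma nrm2_eq0 x : nrm2 x = 0 -> x = 0.
Proof. by move=> h; apply: (@ip_eq0 _ _ ip); rewrite -nrm2E h. Qed.

(** Bessel's inequality for the family whose only member is y / |y|. *)
Lemma CauchySchwarz_nsq x y : nsq (ip x y) <= nrm2 x * nrm2 y.
Proof.
have := nrm2_ge0 ip y; rewrite le_eqVlt => /predU1P[/esym/nrm2_eq0 ->|y0].
  by rewrite ip0r nsq0 mulr_ge0// nrm2_ge0.
pose c := (Num.sqrt (nrm2 y))^-1.
have c2 : c ^+ 2 = (nrm2 y)^-1 by rewrite exprVn sqr_sqrtr// ltW.
pose F n := if n is 0%N then c%:C *: y else 0.
have oF : orthonormal_on ip (pred1 0%N) F.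
  case=> [|i] [|j]; rewrite /F ?ip0l ?ip0r ?andbF//= ipZl ipRr -nrm2E.
  by rewrite mulrA -!real_complexM -expr2 c2 mulVf// gt_eqF.
have := bessel x 1 oF; rewrite big_ord1/= ipRr nsqZ c2 mulrC.
by rewrite ler_pdivrMr.
Qed.

Lemma nrm2N x : nrm2 (- x) = nrm2 x.
Proof. by apply: (@complexI R); rewrite !nrm2E hnormN. Qed.

Lemma nrm2_sub x y : nrm2 (x - y) = nrm2 (y - x).
Proof. by rewrite -nrm2N opprB. Qed.

Lemma closure_nrm2 (S : set H) x (e : R) : closure S x -> 0 < e ->
  exists2 y, S y & nrm2 (x - y) < e.
Proof.
move=> /(_ (ball x (Num.sqrt e)%:C)) cl e0.
have [|y [Sy]] := cl; first by apply: nbhsx_ballx; exact: sqrt_pos.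
by rewrite -ball_normE /= norm_lt_sqrt// => xy; exists y.
Qed.

Lemma approx_orth x y : (forall e : R, 0 < e ->
  exists2 z, ip z y = 0 & nrm2 (x - z) < e) -> ip x y = 0.
Proof.
move=> cl; apply: nsq_eq0; apply/eqP; rewrite eq_le nsq_ge0 andbT leNgt.
apply/negP => h; pose e := nsq (ip x y) / (nrm2 y + 1).
have y1 : 0 < nrm2 y + 1 by have := nrm2_ge0 ip y; lra.
have e0 : 0 < e by rewrite divr_gt0.
have [z zy xz] := cl e e0.
have := CauchySchwarz_nsq (x - z) y; rewrite ipBl zy subr0.
have -> : nsq (ip x y) = e * (nrm2 y + 1) by rewrite divfK// gt_eqF.
by have := nrm2_ge0 ip y; have := nrm2_ge0 ip (x - z); nra.
Qed.

Lemma closure_orth (S : set H) x y : closure S x -> (forall z, S z -> ip z y = 0) ->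
  ip x y = 0.
Proof.
move=> clx Sy; apply: approx_orth => e e0.
by have [z Sz xz] := closure_nrm2 clx e0; exists z; first exact: Sy.
Qed.

Lemma complete_nrm2 (u : nat -> H) :
  (forall e : R, 0 < e -> exists N, forall n, (N <= n)%N -> nrm2 (u N - u n) < e) ->
  exists y, forall e : R, 0 < e ->
    exists N, forall n, (N <= n)%N -> nrm2 (y - u n) < e.
Proof.
move=> cu; have : cvg (u @ \oo).
  suff : cauchy (u @ \oo) by exact: cauchy_cvg.
  apply: cauchy_exP => _ /pos_complexP[r r0 ->].
  have [N HN] := cu _ (exprn_gt0 2 r0); exists (u N); exists N => // n /= Nn.
  by rewrite -ball_normE /= norm_lt ?ltW//; exact: HN.
rewrite cvg_ex => -[y uy]; exists y => e e0.
have /cvgrPdist_lt/(_ _ (sqrt_pos e0))[N _ HN] := uy.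
by exists N => n Nn; rewrite -norm_lt_sqrt//; exact: HN.
Qed.

Lemma compact_nrm2 A (u : nat -> H) : compact_op A -> (forall n, nrm2 (u n) <= 1) ->
  exists y, forall (e : R) N, 0 < e ->
    exists2 n, (N <= n)%N & nrm2 (y - A (u n)) < e.
Proof.
move=> cA u1; have [|y [_ cy]] := cA ((A \o u) @ \oo).
  exists 0%N => // n _ /=; apply: subset_closure; exists (u n) => //=.
  by rewrite (_ : 1 = 1%:C)// norm_le// expr1n.
exists y => e N e0.
have [||z [[n Nn <-]]] := cy [set A (u n) | n in [set n | (N <= n)%N]]
    (ball y (Num.sqrt e)%:C).
- by exists N => // n /= Nn; exists n.
- by apply: nbhsx_ballx; exact: sqrt_pos.
by rewrite -ball_normE /= norm_lt_sqrt// => h; exists n.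
Qed.

Lemma isometry_continuous A : (forall x, nrm2 (A x) <= nrm2 x) -> continuous A.
Proof.
move=> hA; apply: bounded_linear_continuous; apply/bounded_funP => r.
exists r => x xr; apply: le_trans xr.
by rewrite -(@ler_pXn2r _ 2)// ?nnegrE// !norm_nrm2 lecR.
Qed.

End Topology.

(** * Orthonormal expansions and unitaries *)

Section Expansion.
Variables (R : realType) (H : completeNormedModType R[i]).
Variable ip : {dot H for (@conjC R[i])}.
Hypothesis hip : hilbert_norm ip.
Implicit Types (x y z : H) (A : {linear H -> H}) (F : nat -> H) (act : pred nat).
Local Notation nrm2 := (nrm2 ip).

Definition limit_of (u : nat -> H) y := forall e : R, 0 < e ->
  exists N, forall n, (N <= n)%N -> nrm2 (y - u n) < e.

Lemma ip_limit u y z c : limit_of u y ->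
  (exists N, forall n, (N <= n)%N -> ip (u n) z = c) -> ip y z = c.
Proof.
move=> uy [N hN]; apply/eqP; rewrite -subr_eq0; apply/eqP/nsq_eq0/eqP.
rewrite eq_le nsq_ge0 andbT leNgt; apply/negP => h.
pose e := nsq (ip y z - c) / (nrm2 z + 1).
have z1 : 0 < nrm2 z + 1 by have := nrm2_ge0 ip z; lra.
have e0 : 0 < e by rewrite divr_gt0.
have [M hM] := uy e e0.
have := hM (maxn M N) (leq_maxl _ _).
have := CauchySchwarz_nsq ip (y - u (maxn M N)) z.
rewrite ipBl (hN _ (leq_maxr _ _)).
have -> : nsq (ip y z - c) = e * (nrm2 z + 1) by rewrite divfK// gt_eqF.
by have := nrm2_ge0 ip z; have := nrm2_ge0 ip (y - u (maxn M N)); nra.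
Qed.

Lemma ip_comb act F (c : nat -> R[i]) n k : orthonormal_on ip act F ->
  (forall j, ~~ act j -> c j = 0) -> (k < n)%N ->
  ip (\sum_(j < n) c j *: F j) (F k) = c k.
Proof.
move=> oF c0 kn; rewrite ip_suml (bigD1 (Ordinal kn))//= ipZl oF eqxx/=.
rewrite big1 ?addr0.
  by case: (boolP (act k)) => [_|/c0 ->]; rewrite ?mulr1 ?mul0r.
move=> j jk; rewrite ipZl oF [_ == _ :> nat](_ : _ = false) ?mulr0//.
by apply: contraNF jk => /eqP jk; apply/eqP/val_inj.
Qed.

Lemma nrm2_comb act F (c : nat -> R[i]) n : orthonormal_on ip act F ->
  (forall j, ~~ act j -> c j = 0) ->
  nrm2 (\sum_(j < n) c j *: F j) = \sum_(j < n) nsq (c j).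
Proof.
move=> oF c0; apply: (@complexI R); rewrite nrm2E rmorph_sum/= ip_sumr.
apply: eq_bigr => j _; rewrite ipZr (ip_comb oF c0)//.
by rewrite nsqE mulrC.
Qed.

Lemma riesz_fischer act F (c : nat -> R[i]) C : orthonormal_on ip act F ->
  (forall j, ~~ act j -> c j = 0) -> (forall n, \sum_(j < n) nsq (c j) <= C) ->
  exists y, [/\ limit_of (fun n => \sum_(j < n) c j *: F j) y,
    forall j, ip y (F j) = c j & nrm2 y <= C].
Proof.
move=> oF c0 bC; pose u n := \sum_(j < n) c j *: F j.
have diff N n : (N <= n)%N ->
    nrm2 (u n - u N) = \sum_(j < n) nsq (c j) - \sum_(j < N) nsq (c j).
  (* With the first N coefficients replaced by 0, the difference is again a combination to which
     [nrm2_comb] applies. *)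
  move=> Nn; pose c' j := if (j < N)%N then 0 else c j.
  have split_sum (V : zmodType) (f : nat -> V) :
      \sum_(j < n) f j - \sum_(j < N) f j = \sum_(j < n) if (j < N)%N then 0 else f j.
    rewrite -!(big_mkord xpredT f) (big_cat_nat (leq0n N) Nn)/= [X in X - _]addrC addrK.
    rewrite -(big_mkord xpredT (fun j => if (j < N)%N then 0 else f j)).
    rewrite [RHS](big_cat_nat (leq0n N) Nn)/= [X in _ = X + _]big_nat_cond.
    rewrite [X in _ = X + _]big1 ?add0r; last by move=> j /andP[/andP[_ ->]].
    rewrite big_nat_cond [RHS]big_nat_cond; apply: eq_bigr => j /andP[/andP[Nj _] _].
    by rewrite ltnNge Nj.
  have c'0 j : ~~ act j -> c' j = 0 by rewrite /c'; case: ifP => // _ /c0.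
  rewrite /u (split_sum _ (fun j => c j *: F j)) (split_sum _ (fun j => nsq (c j))).
  rewrite (eq_bigr (fun j : 'I_n => c' j *: F j)); last first.
    by move=> j _; rewrite /c'; case: ifP; rewrite ?scale0r.
  rewrite (nrm2_comb _ oF c'0); apply: eq_bigr => j _.
  by rewrite /c'; case: ifP => // _; rewrite nsq0.
have [e e0|y uy] := complete_nrm2 hip (u := u).
  have [N HN] := psum_cauchy (fun j => nsq_ge0 (c j)) bC e0.
  by exists N => n Nn; rewrite nrm2_sub diff//; have := HN n; lra.
have yF j : ip y (F j) = c j.
  by apply: (ip_limit uy); exists j.+1 => n jn; rewrite (ip_comb oF c0).
exists y; split=> //.
rewrite leNgt; apply/negP => h.
have e0 : 0 < nrm2 y - C by lra.
have [N /(_ N (leqnn N))] := uy _ e0.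
have -> : u N = \sum_(j < N) ip y (F j) *: F j.
  by apply: eq_bigr => j _; rewrite yF.
rewrite (nrm2_sub_proj _ _ oF).
have : \sum_(j < N) nsq (ip y (F j)) <= C.
  by under eq_bigr do rewrite yF.
lra.
Qed.

(** The hypothesis on [y] puts it in the closed span of [F]. The sum y' of its Fourier series makes
    y - y' orthogonal to [F], hence to both y and y', so y = y'. *)
Lemma parseval act F y (e : R) : orthonormal_on ip act F ->
  (forall x, (forall j, ip x (F j) = 0) -> ip y x = 0) -> 0 < e ->
  exists n, nrm2 y < \sum_(j < n) nsq (ip y (F j)) + e.
Proof.
move=> oF hy e0; have c0 j : ~~ act j -> ip y (F j) = 0.
  by move=> /(inactive0 oF) ->; rewrite ip0r.
have [y' [ly' yF' _]] := riesz_fischer oF c0 (fun n => bessel y n oF).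
have perp j : ip (y - y') (F j) = 0 by rewrite ipBl yF' subrr.
have yy' : y = y'.
  apply/eqP; rewrite -subr_eq0; apply/eqP/(@ip_eq0 _ _ ip).
  rewrite ipBl (hy _ perp) (ip_limit ly' (c := 0)) ?subrr//.
  exists 0%N => n _; rewrite ip_suml big1// => j _.
  by rewrite ipZl (ip_eq0C (perp j)) mulr0.
have [N /(_ N (leqnn N))] := ly' e e0.
by rewrite -yy' (nrm2_sub_proj _ _ oF) => h; exists N; lra.
Qed.

Lemma make_linear (f : H -> H) :
  (forall a x y, f (a *: x + y) = a *: f x + f y) ->
  exists F : {linear H -> H}, forall x, F x = f x.
Proof.
move=> lf.
pose F : {linear H -> H} := HB.pack f (GRing.isLinear.Build R[i] H H *:%R f lf).
by exists F.
Qed.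

Section Unitary.
Variable I : countType.
Implicit Types (e g : I -> H).

Definition orthonormal_family e := forall i j, ip (e i) (e j) = (i == j)%:R.
Definition total_family e := forall x, (forall i, ip x (e i) = 0) -> x = 0.

(* A countable family as a sequence, padded with zeros. *)
Definition seq_of e (k : nat) : H := oapp e 0 (@pickle_inv I k).
Definition in_range (P : pred I) (k : nat) : bool := oapp P false (@pickle_inv I k).

Lemma seq_of_orthonormal_on (P : pred I) e :
  (forall i j, ip (e i) (e j) = ((i == j) && P i)%:R) ->
  orthonormal_on ip (in_range P) (seq_of e).
Proof.
move=> oe k l; rewrite /seq_of /in_range.
case ek : (@pickle_inv I k) => [i|]; case el : (@pickle_inv I l) => [j|] /=;
  rewrite ?ip0l ?ip0r ?andbF//.
- have -> : (k == l) = (i == j).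
    apply/eqP/eqP => [kl|ij]; first by move: ek; rewrite kl el => -[].
    by have := @pickle_invK I k; have := @pickle_invK I l; rewrite ek el /= ij => -> .
  by rewrite oe; case: eqVneq => // ->.
- by case: eqVneq => // kl; move: ek; rewrite kl el.
Qed.

Lemma seq_of_orthonormal e :
  orthonormal_family e -> orthonormal_on ip (in_range predT) (seq_of e).
Proof. by move=> oe; apply: seq_of_orthonormal_on => i j; rewrite oe andbT. Qed.

Lemma seq_of_pickle e i : seq_of e (pickle i) = e i.
Proof. by rewrite /seq_of pickleK_inv. Qed.

Lemma seq_of_orth e x :
  (forall k, ip x (seq_of e k) = 0) <-> (forall i, ip x (e i) = 0).
Proof.
split=> [h i|h k]; first by rewrite -seq_of_pickle.
by rewrite /seq_of; case: (@pickle_inv I k) => [i|] /=; rewrite ?ip0r.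
Qed.

(** [U] sends [g i] to [e i]. The value at x is the Riesz-Fischer sum with coefficients <x, g_i>;
    totality of [e] makes it unique, hence linear in x. *)
Lemma transport_basis e g : orthonormal_family e -> orthonormal_family g ->
  total_family e ->
  exists U : {linear H -> H}, forall x, nrm2 (U x) <= nrm2 x /\
    forall i, ip (U x) (e i) = ip x (g i).
Proof.
move=> oe og te.
have ex x : exists y, nrm2 y <= nrm2 x /\ forall i, ip y (e i) = ip x (g i).
  have [k nk|y [_ yF ny]] := riesz_fischer (seq_of_orthonormal oe)
      (c := fun k => ip x (seq_of g k)) _ (fun n => bessel x n (seq_of_orthonormal og)).
    by rewrite (inactive0 (seq_of_orthonormal og) nk) ip0r.
  by exists y; split=> // i; rewrite -!seq_of_pickle yF.
have [f fP] := choice ex.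
have [|U UE] := @make_linear f.
  move=> a x y; apply/eqP; rewrite -subr_eq0; apply/eqP/te => i.
  by rewrite ipBl ipDl ipZl !(fP _).2 ipDl ipZl subrr.
by exists U => x; rewrite UE.
Qed.

Lemma unitary_of_bases e g : orthonormal_family e -> orthonormal_family g ->
  total_family e -> total_family g ->
  exists U U' : {linear H -> H}, unitary_with_adjoint ip U U' /\
    forall i, U' (e i) = g i.
Proof.
move=> oe og te tg.
have [U UP] := transport_basis oe og te; have [U' UP'] := transport_basis og oe tg.
have UK : cancel U U'.
  move=> x; apply/eqP; rewrite -subr_eq0; apply/eqP/tg => i.
  by rewrite ipBl (UP' _).2 (UP _).2 subrr.
have UK' : cancel U' U.
  move=> x; apply/eqP; rewrite -subr_eq0; apply/eqP/te => i.
  by rewrite ipBl (UP _).2 (UP' _).2 subrr.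
(* Mutually inverse contractions are isometries; polarization with y and i y then preserves the
   inner product. *)
have nU x : ip (U x) (U x) = ip x x.
  rewrite -!nrm2E; congr (_%:C); apply/eqP; rewrite eq_le (UP x).1/=.
  by rewrite -{1}(UK x) (UP' _).1.
have reU x y : complex.Re (ip (U x) (U y)) = complex.Re (ip x y).
  have := nU (x + y); rewrite linearD !ipDl !ipDr !nU [ip (U y) (U x)]ipC [ip y x]ipC.
  move=> /(congr1 (@complex.Re R)).
  by case: (ip x x) (ip y y) (ip (U x) (U y)) (ip x y) => [a b] [c d] [k l] [m n] /=; lra.
have ipU x y : ip (U x) (U y) = ip x y.
  have UZ a z : U (a *: z) = a *: U z by exact: linearZ.
  have := reU x y; have := reU x ((0 +i* 1) *: y); rewrite UZ !ipZr.
  case: (ip (U x) (U y)) (ip x y) => [a b] [c d] /= h ->; congr (_ +i* _).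
  by move: h; rewrite !mul0r !sub0r mulN1r mulN1r; lra.
exists U, U'; split.
  split=> //; first by apply: (isometry_continuous hip) => x; exact: (UP x).1.
  by move=> x y; rewrite -{1}(UK' y) ipU.
move=> i; apply/eqP; rewrite -subr_eq0; apply/eqP/tg => j.
by rewrite ipBl (UP' _).2 oe og subrr.
Qed.

End Unitary.
End Expansion.

(** * Gram-Schmidt *)

Section GramSchmidt.
Variables (R : realType) (H : completeNormedModType R[i]).
Variable ip : {dot H for (@conjC R[i])}.
Implicit Types (x y z : H) (P : H -> Prop).
Local Notation nrm2 := (nrm2 ip).

(* The vector 0 is normalized to 0, so dependent vectors produce zeros below. *)
Definition normalize x : H := (Num.sqrt (nrm2 x))^-1%:C *: x.

Lemma normalize_eq0 x : normalize x = 0 -> x = 0.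
Proof.
move/eqP; rewrite scaler_eq0 => /orP[/eqP/(@complexI R)/eqP|/eqP//].
rewrite invr_eq0 sqrtr_eq0 => n0; apply: (@nrm2_eq0 _ _ ip).
by apply/eqP; rewrite eq_le n0 nrm2_ge0.
Qed.

Lemma normalizeK x : x = (Num.sqrt (nrm2 x))%:C *: normalize x.
Proof.
have [->|x0] := eqVneq x 0; first by rewrite /normalize !scaler0.
rewrite /normalize scalerA -real_complexM mulfV ?scale1r//.
rewrite sqrtr_eq0 -ltNge lt_neqAle nrm2_ge0 andbT eq_sym.
by apply: contra_neq x0 => /nrm2_eq0.
Qed.

Lemma ip_normalize x : normalize x != 0 -> ip (normalize x) (normalize x) = 1.
Proof.
move=> x0; have {}x0 : 0 < nrm2 x.
  rewrite lt_neqAle nrm2_ge0 andbT eq_sym.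
  by apply: contra_neq x0 => /nrm2_eq0 ->; rewrite /normalize scaler0.
rewrite ipZl ipRr -nrm2E mulrA -!real_complexM -expr2 exprVn sqr_sqrtr ?mulVf//.
  by rewrite gt_eqF.
exact: ltW.
Qed.

Definition submodule P := P 0 /\ forall a x y, P x -> P y -> P (a *: x + y).

Lemma submoduleZ P a x : submodule P -> P x -> P (a *: x).
Proof. by move=> [P0 PD] Px; rewrite -[_ *: _]addr0; exact: PD. Qed.

Lemma submodule_sum P n (c : 'I_n -> R[i]) (f : 'I_n -> H) : submodule P ->
  (forall j, P (f j)) -> P (\sum_j c j *: f j).
Proof. by move=> [P0 PD] Pf; elim/big_rec: _ => // j x _; exact: PD. Qed.

Section Process.
Variable w : nat -> H.

(** Each vector depends on all earlier ones, so the structural recursion builds whole prefixes of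
    the sequence. *)
Fixpoint gs_prefix n : nat -> H :=
  if n is m.+1 then
    fun k => if k == m then
      normalize (w m - \sum_(j < m) ip (w m) (gs_prefix m j) *: gs_prefix m j)
    else gs_prefix m k
  else fun=> 0.

Definition gs k := gs_prefix k.+1 k.

Lemma gs_prefixE n k : (k < n)%N -> gs_prefix n k = gs k.
Proof.
elim: n => // n IH; rewrite ltnS leq_eqVlt => /predU1P[->//|kn].
by rewrite /= ltn_eqF// IH.
Qed.

Definition gs_residue k := w k - \sum_(j < k) ip (w k) (gs j) *: gs j.

Lemma gsE k : gs k = normalize (gs_residue k).
Proof.
rewrite /gs /= eqxx; congr (normalize (_ - _)).
by apply: eq_bigr => j _; rewrite gs_prefixE.
Qed.

Let act k := gs k != 0.

Lemma gs_orthonormal : orthonormal_on ip act gs.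
Proof.
suff H0 n i j : (i < n)%N -> (j < n)%N -> ip (gs i) (gs j) = ((i == j) && act j)%:R.
  by move=> i j; apply: (H0 (maxn i j).+1); lia.
elim: n i j => // n IH.
have step i : (i < n)%N -> ip (gs n) (gs i) = 0.
  move=> ni; pose F j := if (j < n)%N then gs j else 0.
  have oF : orthonormal_on ip (fun j => (j < n)%N && act j) F.
    move=> k l; rewrite /F; case: ltnP => kn; case: ltnP => ln.
    - exact: IH.
    - by rewrite ip0r andbF.
    - by rewrite ip0l; case: eqVneq => // kl; move: kn; rewrite kl leqNgt ln.
    - by rewrite ip0r andbF.
  have Fi : F i = gs i by rewrite /F ni.
  rewrite gsE /normalize ipZl ipBl -Fi.
  have -> : \sum_(j < n) ip (w n) (gs j) *: gs j = \sum_(j < n) ip (w n) (F j) *: F j.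
    by apply: eq_bigr => j _; rewrite /F ltn_ord.
  by rewrite (ip_proj _ _ _ oF) ni subrr mulr0.
move=> i j; rewrite !ltnS leq_eqVlt => /predU1P[->|ni];
  rewrite leq_eqVlt => /predU1P[->|nj].
- rewrite eqxx /act /=; have [->|g0] := eqVneq (gs n) 0; first by rewrite ip0l.
  by rewrite gsE ip_normalize// -gsE.
- by rewrite step// gtn_eqF.
- by rewrite (ip_eq0C (step _ ni)) ltn_eqF.
- exact: IH.
Qed.

Lemma gs_inactive k : ~~ act k -> w k = \sum_(j < k) ip (w k) (gs j) *: gs j.
Proof.
rewrite negbK => /eqP; rewrite gsE => /normalize_eq0/eqP.
by rewrite subr_eq0 => /eqP.
Qed.

Lemma gs_in P k : submodule P -> (forall j, (j <= k)%N -> P (w j)) -> P (gs k).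
Proof.
move=> sP; elim/ltn_ind: k => k IH Pw; rewrite gsE; apply: submoduleZ => //.
rewrite /gs_residue addrC -scaleN1r; apply: sP.2; last exact: Pw.
apply: submodule_sum => // j; apply: IH => // i ij; apply: Pw.
by have := ltn_ord j; lia.
Qed.

Lemma gs_orth x : (forall j, ip x (gs j) = 0) -> forall j, ip x (w j) = 0.
Proof.
move=> h j; have -> : w j = gs_residue j + \sum_(i < j) ip (w j) (gs i) *: gs i.
  by rewrite subrK.
rewrite ipDr (normalizeK (gs_residue j)) -gsE ipRr h mulr0 add0r ip_sumr big1//.
by move=> i _; rewrite ipZr h mulr0.
Qed.

End Process.

Lemma orthonormal_on_eq act act' F : act =1 act' ->
  orthonormal_on ip act F -> orthonormal_on ip act' F.
Proof. by move=> aa oF i j; rewrite oF aa. Qed.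

Lemma has_dim_orthonormal (V : set H) n : has_dim V n ->
  exists z : nat -> H, [/\ orthonormal_on ip (fun j => (j < n)%N) z,
    forall j, V (z j) &
    forall x, (forall j, ip x (z j) = 0) -> forall v, V v -> ip x v = 0].
Proof.
move=> [b [free ->]]; pose w j : H := oapp b 0 (insub j).
have wb (j : 'I_n) : w j = b j by rewrite /w valK.
have w0 j : (n <= j)%N -> w j = 0 by move=> nj; rewrite /w insubF// ltnNge nj.
have subV : submodule [set x | exists c : 'I_n -> R[i], x = \sum_i c i *: b i].
  split; first by exists (fun=> 0); rewrite big1// => i _; rewrite scale0r.
  move=> a x y [c ->] [d ->]; exists (fun i => a * c i + d i).
  rewrite scaler_sumr -big_split/=; apply: eq_bigr => i _.
  by rewrite scalerDl scalerA.
exists (gs w); split.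
- apply: orthonormal_on_eq (gs_orthonormal w) => k /=.
  have [kn|nk] := ltnP k n; last first.
    apply/negbTE; rewrite negbK gsE /gs_residue w0//.
    rewrite big1 ?subrr ?/normalize ?scaler0// => j _.
    by rewrite ip0l scale0r.
  apply: contraT => /gs_inactive wk.
  (* P is the span of the first k basis vectors. If [gs w k] were 0, the vector [w k] would lie in
     it, against linear independence. *)
  pose P x := exists c : 'I_n -> R[i],
    (forall i : 'I_n, (k <= i)%N -> c i = 0) /\ x = \sum_i c i *: b i.
  have sP : submodule P.
    split.
      by exists (fun=> 0); split=> //; rewrite big1// => i _; rewrite scale0r.
    move=> a x y [c [c0 ->]] [d [d0 ->]]; exists (fun i => a * c i + d i); split.
      by move=> i ki; rewrite c0// d0// mulr0 addr0.
    rewrite scaler_sumr -big_split/=; apply: eq_bigr => i _.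
    by rewrite scalerDl scalerA.
  have Pw j : (j < k)%N -> P (w j).
    move=> jk; exists (fun i : 'I_n => (i == j :> nat)%:R); split.
      by move=> i ki; rewrite gtn_eqF//; exact: leq_trans jk ki.
    have jn := ltn_trans jk kn.
    rewrite (bigD1 (Ordinal jn))//= eqxx scale1r big1 ?addr0.
      by rewrite -wb.
    move=> i ij; rewrite [_ == _ :> nat](_ : _ = false) ?scale0r//.
    by apply: contraNF ij => /eqP ij; apply/eqP/val_inj.
  have : P (w k).
    rewrite wk; apply: submodule_sum => // j; apply: gs_in => // i ij.
    by apply: Pw; have := ltn_ord j; lia.
  move=> [c [c0 wc]]; pose K := Ordinal kn.
  have := free (fun i => c i - (i == K)%:R) _ K; rewrite c0// eqxx.
  rewrite sub0r => H0; exfalso.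
  suff /eqP : - 1 = 0 :> R[i] by rewrite oppr_eq0 oner_eq0.
  apply: H0; under eq_bigr do rewrite scalerBl.
  rewrite sumrB -wc (bigD1 K)//= eqxx scale1r big1 ?addr0.
    by rewrite (wb K) subrr.
  by move=> i /negPf ->; rewrite scale0r.
- move=> k; apply: (gs_in (P := [set x | exists c, x = \sum_i c i *: b i])) => // j _.
  have [jn|nj] := ltnP j n; last by rewrite w0//; exact: subV.1.
  exists (fun i : 'I_n => (i == j :> nat)%:R).
  rewrite (bigD1 (Ordinal jn))//= eqxx scale1r big1 ?addr0.
    by rewrite -wb.
  move=> i ij; rewrite [_ == _ :> nat](_ : _ = false) ?scale0r//.
  by apply: contraNF ij => /eqP ij; apply/eqP/val_inj.
- move=> x xz v [c ->]; rewrite ip_sumr big1// => i _.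
  by rewrite ipZr -wb (gs_orth xz) mulr0.
Qed.

End GramSchmidt.

(** * Spectral theorem for positive compact operators *)

Section Spectral.
Variables (R : realType) (H : completeNormedModType R[i]).
Variable ip : {dot H for (@conjC R[i])}.
Hypothesis hip : hilbert_norm ip.
Variable A : {linear H -> H}.
Hypothesis cA : continuous A.
Hypothesis kA : compact_op A.
Hypothesis pA : positive_op ip A.
Implicit Types (x y z : H) (a b t : R).
Local Notation nrm2 := (nrm2 ip).

Let AZ c x : A (c *: x) = c *: A x. Proof. exact: linearZ. Qed.

Let AD x y : A (x + y) = A x + A y. Proof. exact: linearD. Qed.
Let AB x y : A (x - y) = A x - A y. Proof. exact: linearB. Qed.

Definition quad x : R := complex.Re (ip (A x) x).

Lemma quadE x : (quad x)%:C = ip (A x) x.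
Proof. by rewrite RRe_real// ger0_real. Qed.

Lemma quad_ge0 x : 0 <= quad x.
Proof. by rewrite -ler0c quadE. Qed.

(** Over the complex numbers positivity suffices: <A z, z> is real for z = x + y and for z = x + i
    y. *)
Lemma selfadjoint : is_adjoint ip A A.
Proof.
move=> x y; rewrite [RHS]ipC.
have h x1 y1 : ip (A (x1 + y1)) (x1 + y1) =
    ip (A x1) x1 + ip (A y1) y1 + (ip (A x1) y1 + ip (A y1) x1).
  by rewrite AD !ipDl !ipDr; ring.
have := h x y; rewrite -!quadE => /(congr1 (@complex.Im R)).
have := h x ((0 +i* 1) *: y); rewrite -!quadE AZ ipZl ipZr => /(congr1 (@complex.Im R)).
case: (ip (A x) y) (ip (A y) x) => [a b] [c d] /= h1 h2.
by congr (_ +i* _); lra.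
Qed.

Lemma nrm2D x y : nrm2 (x + y) = nrm2 x + nrm2 y + 2 * complex.Re (ip x y).
Proof.
rewrite /nrm2 !ipDl !ipDr [ip y x]ipC.
by case: (ip x x) (ip y y) (ip x y) => [a b] [c d] [k l] /=; ring.
Qed.

Lemma nrm2Z a x : nrm2 (a%:C *: x) = a ^+ 2 * nrm2 x.
Proof.
by rewrite /nrm2 ipZl ipRr; case: (ip x x) => k l /=; ring.
Qed.

Lemma nrm2B x y : nrm2 (x - y) = nrm2 x + nrm2 y - 2 * complex.Re (ip x y).
Proof.
rewrite /nrm2 !ipBl !ipBr [ip y x]ipC.
by case: (ip x x) (ip y y) (ip x y) => [a b] [c d] [k l] /=; ring.
Qed.

Lemma nrm2_add_le x y : nrm2 (x + y) <= 2 * (nrm2 x + nrm2 y).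
Proof. by have := nrm2_ge0 ip (x - y); rewrite nrm2B nrm2D; lra. Qed.

Lemma nrm2_sub_eigen a x :
  nrm2 (A x - a%:C *: x) = nrm2 (A x) - 2 * a * quad x + a ^+ 2 * nrm2 x.
Proof.
by rewrite nrm2B nrm2Z ipRr /quad; case: (ip (A x) x) => k l /=; ring.
Qed.

Lemma quadB t x : quad (x - t%:C *: A x) = quad x - 2 * t * nrm2 (A x) + t ^+ 2 * quad (A x).
Proof.
rewrite /quad AB AZ !ipBl !ipBr !ipZl !ipRr (selfadjoint (A x) x) /nrm2.
case: (ip (A x) x) => k l; case: (ip (A x) (A x)) => m n.
by case: (ip (A (A x)) (A x)) => c d /=; ring.
Qed.

Lemma bounded_op : exists2 M, 0 < M & forall x, nrm2 (A x) <= M * nrm2 x.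
Proof.
have /linear_boundedP/pinfty_ex_gt0[_ /pos_complexP[M M0 ->] HM] :=
  continuous_linear_bounded 0 (cA (x := 0)).
exists (M ^+ 2); first exact: exprn_gt0.
move=> x; rewrite -lecR rmorphM/= -!(norm_nrm2 hip) (rmorphXn (real_complex R)).
rewrite -exprMn ler_pXn2r// nnegrE// mulr_ge0//.
by rewrite ler0c ltW.
Qed.

Variable v : nat -> H.
Variable s : nat -> R.
Hypothesis Av : forall j, A (v j) = (s j)%:C *: v j.
Hypothesis no_eigen : forall (lambda : R) x, 0 < lambda -> A x = lambda%:C *: x ->
  (forall j, ip x (v j) = 0) -> x = 0.

Let V x := forall j, ip x (v j) = 0.

Let VA x : V x -> V (A x).
Proof. by move=> Vx j; rewrite selfadjoint Av ipRr Vx mulr0. Qed.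

(* Expand 0 <= <A y, y> for y = x - A x / M. *)
Lemma image_bound (M : R) : 0 < M -> (forall x, V x -> quad x <= M * nrm2 x) ->
  forall x, V x -> nrm2 (A x) <= M * quad x.
Proof.
move=> M0 HM x Vx; have := quad_ge0 (x - (M^-1)%:C *: A x); rewrite quadB.
have := HM _ (VA Vx); rewrite -ler_pdivrMl// => h1 h2.
have M1 : 0 < M^-1 by rewrite invr_gt0.
have h3 : M^-1 ^+ 2 * quad (A x) <= M^-1 * nrm2 (A x).
  by rewrite expr2 -mulrA ler_wpM2l// ltW.
rewrite -ler_pdivrMl//; nra.
Qed.

(* Otherwise the supremum of <A x, x> over the unit ball of the orthogonal
   complement of the v_j is attained, by compactness, at an eigenvector. *)
Lemma orth_eigen_kernel x : V x -> A x = 0.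
Proof.
move=> Vx; apply: contrapT => Ax0.
have [M M0 HM] := bounded_op.
pose S := [set quad y | y in [set y | V y /\ nrm2 y <= 1]].
have qn y : quad y ^+ 2 <= nrm2 (A y) * nrm2 y.
  apply: le_trans (CauchySchwarz_nsq ip (A y) y).
  by rewrite -quadE /nsq /= expr0n/= addr0.
have supS : has_sup S.
  split; first by exists (quad 0), 0 => //; split; rewrite /V /nrm2 ?ip0l//= => j; rewrite ip0l.
  exists (M + 1) => _ [y [_ y1] <-].
  have := qn y; have := HM y; have := nrm2_ge0 ip y; have := nrm2_ge0 ip (A y); have := quad_ge0 y.
  nra.
pose l := sup S.
have ql y : V y -> quad y <= l * nrm2 y.
  move=> Vy; have [->|y0] := eqVneq y 0.
    by rewrite /quad /nrm2 !ip0r /= mulr0.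
  have n0 : 0 < nrm2 y.
    by rewrite lt_neqAle nrm2_ge0 andbT eq_sym; apply: contra_neq y0 => /nrm2_eq0.
  pose c := (Num.sqrt (nrm2 y))^-1.
  have c2 : c ^+ 2 = (nrm2 y)^-1 by rewrite exprVn sqr_sqrtr// ltW.
  have : quad (c%:C *: y) <= l.
    apply: ub_le_sup; first exact: supS.2.
    exists (c%:C *: y) => //; split; first by move=> j; rewrite ipZl Vy mulr0.
    by rewrite nrm2Z c2 mulVf// gt_eqF.
  have -> : quad (c%:C *: y) = c ^+ 2 * quad y.
    by rewrite /quad AZ ipZl ipRr; case: (ip (A y) y) => k m /=; ring.
  by rewrite c2 mulrC ler_pdivrMr.
have l0 : 0 < l.
  rewrite ltNge; apply/negP => ln; apply: Ax0; apply: (@nrm2_eq0 _ _ ip).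
  have q0 y : V y -> quad y <= 0.
    by move=> /ql h; apply: le_trans h _; have := nrm2_ge0 ip y; nra.
  (* If l <= 0 the form is nonpositive on V, so [image_bound] with the arbitrary constant 1 gives A
     x = 0. *)
  have := @image_bound 1 ltr01 _ x Vx.
  apply: contraPeq => nA /(_ _)/wrap[y Vy|].
    by rewrite mul1r; apply: le_trans (q0 _ Vy) (nrm2_ge0 _ _).
  have := q0 _ Vx; have : 0 < nrm2 (A x) by rewrite lt_neqAle nrm2_ge0 eq_sym nA.
  lra.
have im := image_bound l0 ql.
have exu n : exists y, [/\ V y, nrm2 y <= 1 & l - n.+1%:R^-1 < quad y].
  have n0 : 0 < n.+1%:R^-1 :> R by rewrite invr_gt0.
  by have [_ [y [Vy y1] <-] h] := sup_adherent n0 supS; exists y.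
have [u uP] := choice exu.
have u1 n : nrm2 (u n) <= 1 by have [] := uP n.
have [y cy] := compact_nrm2 hip kA u1.
have near (d e : R) : 0 < d -> 0 < e -> exists2 n, l - d < quad (u n) & nrm2 (y - A (u n)) < e.
  move=> d0 e0; have [N _ HN] : exists2 N, True & N.+1%:R^-1 < d.
    exists (truncn d^-1) => //.
    by rewrite -ltf_pV2 ?posrE ?invr_gt0// invrK truncnS_gt.
  have [n Nn yn] := cy e N e0; exists n => //.
  have [_ _ h] := uP n; apply: le_lt_trans h; rewrite lerD2l lerN2.
  apply: le_trans (ltW HN); rewrite lef_pV2 ?posrE// ler_nat.
  exact: leq_ltn_trans Nn _.
have Vy : V y.
  move=> j; apply: (@approx_orth _ _ ip) => e e0.
  have [n _ yn] := near 1 e ltr01 e0; exists (A (u n)) => //.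
  by apply: VA; have [] := uP n.
have Ay : A y = l%:C *: y.
  apply/eqP; rewrite -subr_eq0; apply/eqP/(@nrm2_eq0 _ _ ip)/eqP.
  rewrite eq_le nrm2_ge0 andbT leNgt; apply/negP => h.
  (* The estimates below add up to at most (4 M + 4 l^2 + 2 M l) e, which is strictly less than K
     e. *)
  pose K := 4 * (2 * M + l ^+ 2 + M * l + 1).
  have K0 : 0 < K by rewrite /K; have := mulr_ge0 (ltW M0) (ltW l0); nra.
  pose e := nrm2 (A y - l%:C *: y) / K.
  have e0 : 0 < e by rewrite divr_gt0.
  have [n qn' yn] := near e e e0 e0.
  have [Vu un _] := uP n.
  have dec : A y - l%:C *: y =
      (A (y - A (u n)) + l%:C *: (A (u n) - y)) + A (A (u n) - l%:C *: u n).
    rewrite !AB AZ !scalerBr addrACA subrK.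
    by rewrite [X in _ = _ + X]addrAC subrr sub0r.
  have : nrm2 (A y - l%:C *: y) = e * K by rewrite divfK// gt_eqF.
  have b1 := HM (y - A (u n)).
  have b2 : nrm2 (l%:C *: (A (u n) - y)) = l ^+ 2 * nrm2 (y - A (u n)).
    by rewrite nrm2Z nrm2_sub.
  have b3 := HM (A (u n) - l%:C *: u n).
  (* Maximizing vectors are nearly eigenvectors: by [im] the left side is at most l (l - <A u,
     u>). *)
  have b4 : nrm2 (A (u n) - l%:C *: u n) <= l * e.
    rewrite nrm2_sub_eigen; have := im _ Vu; nra.
  have b5 := nrm2_add_le (A (y - A (u n)) + l%:C *: (A (u n) - y)) (A (A (u n) - l%:C *: u n)).
  have b6 := nrm2_add_le (A (y - A (u n))) (l%:C *: (A (u n) - y)).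
  rewrite -dec in b5; rewrite b2 in b6.
  have b7 : M * nrm2 (A (u n) - l%:C *: u n) <= M * (l * e) by rewrite ler_wpM2l// ltW.
  have b8 : M * nrm2 (y - A (u n)) <= M * e by rewrite ler_wpM2l// ltW.
  have b9 : l ^+ 2 * nrm2 (y - A (u n)) <= l ^+ 2 * e by rewrite ler_wpM2l ?sqr_ge0// ltW.
  rewrite /K => h1.
  have : e * (4 * (2 * M + l ^+ 2 + M * l + 1)) =
     8 * (M * e) + 4 * (l ^+ 2 * e) + 4 * (M * (l * e)) + 4 * e by ring.
  have := mulr_ge0 (ltW M0) (mulr_ge0 (ltW l0) (ltW e0)).
  have := mulr_ge0 (ltW M0) (ltW e0).
  lra.
(* With y = 0 some [A (u n)] has norm below l / 2, although <A u, u> > l / 2 on the unit ball,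
   against Cauchy-Schwarz. *)
have y0 := no_eigen l0 Ay Vy.
have l4 : 0 < l ^+ 2 / 4 by have := exprn_gt0 2 l0; lra.
have l2 : 0 < l / 2 by lra.
have [n qn'] := near _ _ l2 l4; rewrite y0 sub0r nrm2N => nA.
have := qn (u n); have := u1 n; have := nrm2_ge0 ip (u n); have := nrm2_ge0 ip (A (u n)).
nra.
Qed.

End Spectral.

Section SingularBasis.
Variables (R : realType) (H : completeNormedModType R[i]).
Variable ip : {dot H for (@conjC R[i])}.
Hypothesis hip : hilbert_norm ip.
Variable A : {linear H -> H}.
Hypothesis hA : compact_positive ip A.
Implicit Types (x y z : H) (a b t : R).
Local Notation nrm2 := (nrm2 ip).

Lemma eigen_orth a b x y : A x = a%:C *: x -> A y = b%:C *: y -> a <> b -> ip x y = 0.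
Proof.
case: hA => _ _ pA Ax Ay ab.
have := selfadjoint pA x y; rewrite Ax Ay ipZl ipRr => /eqP.
rewrite -subr_eq0 -mulrBl mulf_eq0 => /orP[|/eqP//].
by rewrite -rmorphB => /eqP/(@complexI R)/eqP; rewrite subr_eq0 => /eqP.
Qed.

Definition eigenbasis (s : nat -> R) (v : nat -> H) := 
  [/\ orthonormal_on ip (fun j => 0 < s j) v,
    forall j, A (v j) = (s j)%:C *: v j &
    forall x, (forall j, ip x (v j) = 0) -> A x = 0].

(** For each l > 0 an orthonormal basis of the eigenspace is numbered by the indices j with
    [s j = l]; these bases are glued together. An eigenvector orthogonal to all of them is
    orthogonal to its own eigenspace, so the spectral lemma applies. *)
Lemma singular_basis s : singular_values A s -> exists v, eigenbasis s v.
Proof.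
move=> [s0 sN seig].
have ex (l : R) : exists zf : (nat -> H) * (nat -> nat), 0 < l ->
  exists n, [/\ orthonormal_on ip (fun j => (j < n)%N) zf.1,
    forall j, A (zf.1 j) = l%:C *: zf.1 j,
    forall x, (forall j, ip x (zf.1 j) = 0) -> forall y, A y = l%:C *: y -> ip x y = 0 &
    set_bij [set j | s j = l] `I_n zf.2].
  have [l0|ln] := boolP (0 < l); last by exists (fun=> 0, id).
  have [n [dimn /card_set_bijP[f bijf]]] := seig l l0.
  have [z [oz Vz totz]] := has_dim_orthonormal ip dimn.
  by exists (z, f) => _; exists n; split.
have [zf zfP] := choice ex.
pose v j := if 0 < s j then (zf (s j)).1 ((zf (s j)).2 j) else 0.
have Av j : A (v j) = (s j)%:C *: v j.
  rewrite /v; case: ifP => [sj|_]; last by rewrite linear0 scaler0.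
  by have [n [_ -> _ _]] := zfP _ sj.
exists v; split=> //.
- move=> i j; have [si|si] := boolP (0 < s i); last first.
    rewrite {1}/v (negPf si) ip0l; case: eqVneq => // <-.
    by rewrite (negPf si).
  have [sj|sj] := boolP (0 < s j); last by rewrite {2}/v (negPf sj) ip0r andbF.
  have [sij|sij] := eqVneq (s i) (s j); last first.
    rewrite (eigen_orth (Av i) (Av j)); last exact/eqP.
    by case: eqVneq => // ij; rewrite ij eqxx in sij.
  rewrite /v si sj sij; have [n [oz _ _ [fn finj _]]] := zfP _ sj.
  rewrite oz; have -> : ((zf (s j)).2 j < n)%N by exact: fn.
  congr (nat_of_bool (_ && _))%:R; apply/eqP/eqP => [|->//].
  by apply: finj; rewrite inE /=.
- move=> x xv; case: hA => cA kA pA.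
  apply: (orth_eigen_kernel hip cA kA pA Av) xv => l y l0 Ay yv.
  have [n [oz _ tz [_ _ fsurj]]] := zfP _ l0.
  apply: (@ip_eq0 _ _ ip); apply: (tz y) => // j.
  have [jn|nj] := ltnP j n; last first.
    by rewrite (inactive0 oz) ?ip0r// -leqNgt.
  have [i /= sil <-] := fsurj j jn.
  by have := yv i; rewrite /v sil l0.
Qed.

(** If all [s j] exceeded e, the images A v_n would have mutual squared distances above 2 e^2,
    whereas two images near a cluster point are at squared distance at most e^2. *)
Lemma eigenbasis_to0 s v : eigenbasis s v -> (forall j k, (j <= k)%N -> s k <= s j) ->
  forall e : R, 0 < e -> exists j, s j <= e.
Proof.
move=> [ov Av _] sN e e0; apply: contrapT => /forallNP h.
have {}h j : e < s j by rewrite ltNge; apply/negP/h.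
case: hA => _ kA _.
have v1 n : ip (v n) (v n) = 1 by rewrite ov eqxx (lt_trans e0 (h n)).
have [|y cy] := compact_nrm2 hip (u := v) kA.
  by move=> n; rewrite /nrm2 v1.
have e2 : 0 < e ^+ 2 / 4 by have := exprn_gt0 2 e0; lra.
have [n _ yn] := cy _ 0%N e2; have [m nm ym] := cy _ n.+1 e2.
have := nrm2_add_le ip (y - A (v m)) (A (v n) - y).
rewrite addrC subrKA (nrm2_sub ip (A (v n)) y).
have -> : nrm2 (A (v n) - A (v m)) = s n ^+ 2 + s m ^+ 2.
  rewrite nrm2B !Av !nrm2Z ipRr ipZl ov ltn_eqF//= /nrm2 !v1 /=.
  by rewrite !mul0r !mulr0; ring.
have := h n; have := h m; nra.
Qed.

End SingularBasis.

(** * Cardinalities of orthonormal families *)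

Section Count.
Local Open Scope card_scope.
Variable R : realType.

Definition belowS (K : option nat) : set nat := [set k | below K k].

Lemma enum_countable (T : Type) (S : set T) : countable S -> exists K, S #= belowS K.
Proof.
move=> cS; have [[n Sn]|infS] := pselect (finite_set S); first by exists (Some n).
exists None; rewrite (_ : belowS None = setT); last by apply/seteqP.
exact: eq_card_nat.
Qed.

Lemma esum_belowS K : \esum_(k in belowS K) (1 : \bar R)%E = ereal_of_onat R K.
Proof.
case: K => [q|] /=.
  rewrite (_ : belowS (Some q) = `I_q)// esum_fset ?finite_II// -fsbig_ord.
  by rewrite sumEFin big_const_ord iter_addr_0.
rewrite (_ : belowS None = setT); last by apply/seteqP.
rewrite -nneseries_esumT//; apply/eqyP => A A0.
have [n An] : exists n : nat, A <= n%:R.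
  by exists (truncn A).+1; apply/ltW/truncnS_gt.
apply: (@le_trans _ _ (\sum_(0 <= k < n) (1 : \bar R))%E); last exact: nneseries_lim_ge.
by rewrite sumEFin lee_fin big_const_nat subn0 iter_addr_0.
Qed.

Lemma esum_card (T : choiceType) (S : set T) K : S #= belowS K ->
  \esum_(k in S) (1 : \bar R)%E = ereal_of_onat R K.
Proof.
by move=> /card_set_bijP[h bh]; rewrite -esum_belowS (reindex_esum _ _ h _ bh).
Qed.

Lemma ereal_of_onat_inj : injective (ereal_of_onat R).
Proof.
move=> [p|] [q|] //=.
by move=> [] /eqP; rewrite eqr_nat => /eqP ->.
Qed.

(** Countable cardinals are read off from extended sums of ones, which can be compared by double
    counting of squared coefficients. *)
Lemma card_of_esum (T T' : choiceType) (S : set T) (S' : set T') :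
  countable S -> countable S' ->
  \esum_(k in S) (1 : \bar R)%E = \esum_(k in S') (1 : \bar R)%E -> S #= S'.
Proof.
move=> /enum_countable[K SK] /enum_countable[K' SK'].
rewrite (esum_card SK) (esum_card SK') => /ereal_of_onat_inj KK'.
by apply: card_eq_trans SK _; rewrite card_eq_sym KK'.
Qed.

Lemma esum_bool (T : choiceType) (P : pred T) :
  \esum_(k in [set: T]) ((P k)%:R : R)%:E = \esum_(k in [set k | P k]) (1 : \bar R)%E.
Proof.
rewrite [RHS]esum_mkcond; apply: eq_esum => k _.
case: ifPn; first by rewrite inE /= => ->.
by rewrite notin_setE /= => /negP/negPf ->.
Qed.

Lemma series_bool (P : pred nat) :
  (\sum_(k <oo) ((P k)%:R : R)%:E = \esum_(k in [set k | P k]) (1 : \bar R))%E.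
Proof. by rewrite nneseries_esumT ?esum_bool// => n; rewrite lee_fin. Qed.

Lemma esum_pickle (I : countType) (a : I -> R) : (forall i, 0 <= a i) ->
  (\esum_(i in [set: I]) (a i)%:E =
   \sum_(k <oo) (oapp a 0%R (@pickle_inv I k))%:E)%E.
Proof.
move=> a0; rewrite nneseries_esumT; last first.
  by move=> k; rewrite lee_fin; case: (@pickle_inv I k) => /=.
have <- : \esum_(k in (@pickle I) @` setT) (oapp a 0 (@pickle_inv I k))%:E =
    \esum_(i in [set: I]) (a i)%:E.
  rewrite esum_image; last by move=> i j _ _; exact: (pcan_inj (@pickleK I)).
  by apply: eq_esum => i _; rewrite pickleK_inv.
rewrite esum_mkcond; apply: eq_esum => k _; case: ifPn => //.
rewrite notin_setE; case ek : (@pickle_inv I k) => [i|//] /= nk.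
by exfalso; apply: nk; exists i => //; have := @pickle_invK I k; rewrite ek.
Qed.

End Count.

Section Traces.
Local Open Scope card_scope.
Variables (R : realType) (H : completeNormedModType R[i]).
Variable ip : {dot H for (@conjC R[i])}.
Hypothesis hip : hilbert_norm ip.
Implicit Types (x y z : H) (F G : nat -> H).
Local Notation nrm2 := (nrm2 ip).

(** Membership in the closed span, expressed as membership in the double orthogonal complement. *)
Definition spanned F y := forall x, (forall j, ip x (F j) = 0) -> ip y x = 0.

Lemma parseval_series act F y : orthonormal_on ip act F -> spanned F y ->
  (\sum_(j <oo) (nsq (ip y (F j)))%:E = (nrm2 y)%:E)%E.
Proof.
move=> oF sy; apply/eqP; rewrite eq_le; apply/andP; split.
  apply: lime_le.
    by apply: is_cvg_nneseries => j _ _; rewrite lee_fin nsq_ge0.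
  apply: nearW => n; rewrite sumEFin lee_fin big_mkord; exact: (bessel _ _ oF).
apply/lee_addgt0Pr => e e0.
have [n hn] := parseval hip oF sy e0.
apply: (@le_trans _ _ ((\sum_(j < n) nsq (ip y (F j)))%:E + e%:E)%E).
  by rewrite -EFinD lee_fin ltW.
rewrite leeD2r// -(big_mkord xpredT (fun j => nsq (ip y (F j)))) -sumEFin.
by apply: nneseries_lim_ge => j _ _; rewrite lee_fin nsq_ge0.
Qed.

Lemma double_count act F G : orthonormal_on ip act G ->
  (forall k, spanned G (F k)) ->
  (\sum_(k <oo) (nrm2 (F k))%:E =
   \sum_(j <oo) \sum_(k <oo) (nsq (ip (G j) (F k)))%:E)%E.
Proof.
move=> oG sF; rewrite nneseries_interchange; last first.
  by move=> i j; rewrite lee_fin nsq_ge0.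
apply: eq_eseriesr => k _; rewrite -(parseval_series oG (sF k)).
by apply: eq_eseriesr => j _; rewrite ipC nsq_conj.
Qed.

(** Invariance of Hilbert dimension: by Parseval both counts equal the double sum of |<F_k,
    G_j>|^2. *)
Lemma count_eq actF actG F G : orthonormal_on ip actF F -> orthonormal_on ip actG G ->
  (forall k, spanned G (F k)) -> (forall k, spanned F (G k)) ->
  (\esum_(k in [set k | actF k]) (1 : \bar R) =
   \esum_(k in [set k | actG k]) (1 : \bar R))%E.
Proof.
move=> oF oG sF sG.
have E act G' : orthonormal_on ip act G' ->
    (\esum_(k in [set k | act k]) (1 : \bar R) = \sum_(k <oo) (nrm2 (G' k))%:E)%E.
  move=> oG'; rewrite -series_bool; apply: eq_eseriesr => k _.
  by rewrite /nrm2 oG' eqxx /=; case: (act k).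
rewrite (E _ _ oF) (E _ _ oG) (double_count oG sF).
by apply: eq_eseriesr => j _; rewrite (parseval_series oF (sG j)).
Qed.

Lemma card_in_range (I : countType) (P : pred I) :
  (\esum_(k in [set k | in_range P k]) (1 : \bar R) =
   \esum_(i in [set i | P i]) (1 : \bar R))%E.
Proof.
rewrite -series_bool -esum_bool esum_pickle//.
by apply: eq_eseriesr => k _; rewrite /in_range; case: (@pickle_inv I k).
Qed.

End Traces.

(** * Kernels and diagonal operators *)

Section Spanned.
Local Open Scope card_scope.
Variables (R : realType) (H : completeNormedModType R[i]).
Variable ip : {dot H for (@conjC R[i])}.
Hypothesis hip : hilbert_norm ip.
Implicit Types (x y z : H) (F G : nat -> H).
Local Notation nrm2 := (nrm2 ip).
Local Notation spanned := (spanned ip).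

(** The Fourier sums of [y] approximate it and involve only indices in [S]. *)
Lemma spanned_sub act F (S : pred nat) y : orthonormal_on ip act F -> spanned F y ->
  (forall j, ~~ S j -> ip y (F j) = 0) ->
  spanned (fun j => if S j then F j else 0) y.
Proof.
move=> oF sF yS x xF; apply: approx_orth => e e0.
have [n hn] := parseval hip oF sF e0.
exists (\sum_(j < n) ip y (F j) *: F j); last by rewrite (nrm2_sub_proj _ _ oF); lra.
rewrite ip_suml big1// => j _; rewrite ipZl.
have [Sj|Sj] := boolP (S j); last by rewrite yS ?mul0r.
by have := xF j; rewrite Sj => /ip_eq0C ->; rewrite mulr0.
Qed.

Variables (I : countType) (e : I -> H).
Hypothesis he : orthonormal_basis ip e.

Lemma basis_orthonormal : orthonormal_family ip e.
Proof. by case: he. Qed.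

Lemma basis_total : total_family ip e.
Proof.
move=> x xe; case: he => _ cl; apply: (@ip_eq0 _ _ ip).
have : closure [set x | exists r c, x = \sum_(i <- r) c i *: e i] x by rewrite cl.
move/(closure_orth hip); apply=> _ [r [c ->]].
by rewrite ip_suml big1// => i _; rewrite ipZl (ip_eq0C (xe i)) mulr0.
Qed.

Lemma basis_spanned y : spanned (seq_of e) y.
Proof. by move=> x /seq_of_orth/basis_total ->; rewrite ip0r. Qed.

Lemma spanned_seq_of (G : nat -> H) (f : I -> H) k :
  (forall i, spanned G (f i)) -> spanned G (seq_of f k).
Proof.
move=> sf x xG; rewrite /seq_of; case: (@pickle_inv I k) => [i|] /=; last by rewrite ip0l.
exact: sf.
Qed.

End Spanned.

Section Kernel.
Local Open Scope card_scope.
Variables (R : realType) (H : completeNormedModType R[i]).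
Variable ip : {dot H for (@conjC R[i])}.
Hypothesis hip : hilbert_norm ip.
Variables (I : countType) (e : I -> H).
Hypothesis he : orthonormal_basis ip e.
Variables (A RA : {linear H -> H}).
Hypothesis hA : compact_positive ip A.
Hypothesis hRA : range_projection ip A RA.
Implicit Types (x y z : H) (F G : nat -> H).
Local Notation nrm2 := (nrm2 ip).

Lemma proj_kernel x : RA x = 0 <-> A x = 0.
Proof.
case: hA => _ _ pA; have sA := selfadjoint pA; case: hRA => idRA adjRA rgRA.
split=> [Rx|Ax].
  apply: (@ip_eq0 _ _ ip); rewrite sA.
  have : closure (range A) (A (A x)) by apply: subset_closure; exists (A x).
  by rewrite -rgRA => -[w _ <-]; rewrite -adjRA Rx ip0l.
apply: (@ip_eq0 _ _ ip); rewrite adjRA idRA; apply: ip_eq0C.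
have : closure (range A) (RA x) by rewrite -rgRA; exists x.
by move/(closure_orth hip); apply=> _ [w _ <-]; rewrite sA Ax ip0r.
Qed.

Lemma kernel_component x : A (x - RA x) = 0.
Proof.
by case: hRA => idRA _ _; apply/proj_kernel; rewrite linearB idRA subrr.
Qed.

(** Gram-Schmidt is applied to the projections of the e_i onto ker A, and the zeros it produces are
    skipped by renumbering. The cotrace is the sum of the square norms of these projections, that is
    of all |<z_j, e_i>|^2, and so counts the z_j. *)
Lemma kernel_basis : exists K (z : nat -> H), [/\ orthonormal_on ip (below K) z,
  forall j, A (z j) = 0, forall y, A y = 0 -> spanned ip z y &
  cotrace ip e RA = ereal_of_onat R K].
Proof.
case: hRA => idRA adjRA _.
pose w i := e i - RA (e i); pose u := gs ip (seq_of w).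
have ou := gs_orthonormal ip (seq_of w); rewrite -/u in ou.
set act := (fun k => u k != 0) in ou.
have [K actK] := enum_countable (countableP [set k | act k]).
have /card_set_bijP[h [hK hinj hsurj]] : belowS K #= [set k | act k].
  by rewrite card_eq_sym.
pose z k := if below K k then u (h k) else 0.
have ipw x i : ip x (w i) = ip (x - RA x) (e i) by rewrite ipBr ipBl adjRA.
have Aw k : A (seq_of w k) = 0.
  rewrite /seq_of; case: (@pickle_inv I k) => [i|] /=; last exact: linear0.
  exact: kernel_component.
have subker : submodule [set x | A x = 0].
  split=> /=; first exact: linear0.
  by move=> a x y /= Ax Ay; rewrite linearP Ax Ay scaler0 addr0.
have Au k : A (u k) = 0 by apply: (gs_in ip subker) => j _; exact: Aw.
have oz : orthonormal_on ip (below K) z.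
  move=> i j; rewrite /z; case: (boolP (below K i)) => Ki; last first.
    by rewrite ip0l; case: eqVneq => // <-; rewrite (negPf Ki).
  case: (boolP (below K j)) => Kj; last by rewrite ip0r andbF.
  rewrite ou andbT (hK j Kj : act _) andbT; congr ((nat_of_bool _)%:R).
  by apply/eqP/eqP => [|->//]; apply: hinj; rewrite inE.
have zu x : (forall j, ip x (z j) = 0) -> forall k, ip x (u k) = 0.
  move=> xz k; have [ak|ak] := boolP (act k); last by rewrite (inactive0 ou ak) ip0r.
  have [j Kj <-] := hsurj k ak; have := xz j.
  by rewrite /z (Kj : below K j).
have tz y : A y = 0 -> spanned ip z y.
  move=> Ay x /zu/gs_orth/seq_of_orth xw; apply: ip_eq0C.
  have x0 : x - RA x = 0 by apply: (basis_total hip he) => i; rewrite -ipw.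
  have -> : y = y - RA y by rewrite (proj_kernel y).2 ?subr0.
  by rewrite ipBr -adjRA -ipBl x0 ip0l.
exists K, z; split=> //.
  by move=> j; rewrite /z; case: ifP => // _; exact: linear0.
rewrite /cotrace /trace_pos -(esum_belowS R K).
have -> : \esum_(i in [set: I]) (complex.Re (ip (e i - RA (e i)) (e i)))%:E =
    (\sum_(k <oo) (nrm2 (seq_of w k))%:E)%E.
  have nw i : complex.Re (ip (e i - RA (e i)) (e i)) = nrm2 (w i).
    by rewrite /nrm2 ipw /w linearB idRA subrr subr0.
  rewrite esum_pickle; last by move=> i; rewrite nw nrm2_ge0.
  apply: eq_eseriesr => k _; rewrite /seq_of.
  by case: (@pickle_inv I k) => [i|] /=; rewrite ?nw// /nrm2 ip0l.
rewrite (double_count hip oz); last by move=> k; apply: tz.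
rewrite -(@series_bool R (below K)); apply: eq_eseriesr => j _.
have Rz : RA (z j) = 0.
  by apply/proj_kernel; rewrite /z; case: ifP => // _; exact: linear0.
have -> : ((below K j)%:R : R) = nrm2 (z j).
  by rewrite /nrm2 oz eqxx /=; case: (below K j).
rewrite -(parseval_series hip (seq_of_orthonormal (basis_orthonormal he))
  (basis_spanned hip he (z j))).
apply: eq_eseriesr => k _; congr (nsq _)%:E; rewrite /seq_of.
case: (@pickle_inv I k) => [i|] //=.
by rewrite ipw Rz subr0.
Qed.

End Kernel.

Section Diagonal.
Local Open Scope card_scope.
Variables (R : realType) (H : completeNormedModType R[i]).
Variable ip : {dot H for (@conjC R[i])}.
Hypothesis hip : hilbert_norm ip.
Variables (I : countType) (e : I -> H).
Hypothesis he : orthonormal_basis ip e.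
Variables (B RB : {linear H -> H}).
Hypothesis hB : compact_positive ip B.
Hypothesis hBD : diagonal_algebra ip e B.
Hypothesis hRB : range_projection ip B RB.
Variables (s : nat -> R) (v : nat -> H).
Hypothesis hv : eigenbasis ip B s v.
Implicit Types (x y z : H) (F G : nat -> H).
Local Notation nrm2 := (nrm2 ip).

Definition diag i : R := quad ip B (e i).

Let pB : positive_op ip B. Proof. by case: hB. Qed.
Let oe := basis_orthonormal he.
Let te := basis_total hip he.

Lemma diag_ge0 i : 0 <= diag i. Proof. exact: quad_ge0. Qed.

Lemma diagE i : B (e i) = (diag i)%:C *: e i.
Proof.
apply/eqP; rewrite -subr_eq0; apply/eqP/te => j; rewrite ipBl ipZl oe.
have [<-|ij] := eqVneq i j; first by rewrite mulr1 quadE// subrr.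
by rewrite mulr0 subr0; case: hBD => _; exact.
Qed.

Lemma cotrace_diag :
  cotrace ip e RB = \esum_(i in [set i | diag i == 0]) (1 : \bar R)%E.
Proof.
rewrite -(@esum_bool R I (fun i => diag i == 0)); apply: eq_esum => i _; congr _%:E.
have [d0|d0] := eqVneq (diag i) 0.
  have /(proj_kernel hip hB hRB) -> : B (e i) = 0 by rewrite diagE d0 scale0r.
  by rewrite subr0 oe eqxx.
have -> : RB (e i) = e i.
  case: hRB => idRB _ rgRB.
  have : closure (range B) (e i).
    apply: subset_closure; exists ((diag i)^-1%:C *: e i) => //.
    by rewrite linearZ_LR diagE scalerA -real_complexM mulVf// scale1r.
  by rewrite -rgRB => -[y _ <-].
by rewrite subrr ip0l.
Qed.

(* Both cardinals are the sum of |<e_i, v_j>|^2 over the two level sets. *)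
Lemma level_card (l : R) : 0 < l -> [set i | diag i = l] #= [set j | s j = l].
Proof.
case: hv => ov Bv tv l0; have sB := selfadjoint pB.
have orth i j : diag i <> s j -> ip (e i) (v j) = 0.
  by move=> d; exact: (eigen_orth hB (diagE i) (Bv j)).
pose P i := diag i == l; pose Q j := s j == l.
pose F := seq_of (fun i => if P i then e i else 0).
pose G j := if Q j then v j else 0.
have oF : orthonormal_on ip (in_range P) F.
  apply: seq_of_orthonormal_on => i j.
  case: (boolP (P i)) => Pi; last by rewrite ip0l andbF.
  case: ifP => Pj; first by rewrite oe andbT.
  by rewrite ip0r; case: eqVneq => // ij; rewrite -ij Pi in Pj.
have oG : orthonormal_on ip Q G.
  move=> i j; rewrite /G; case: (boolP (Q i)) => Qi; last first.
    by rewrite ip0l; case: eqVneq => // <-; rewrite (negPf Qi).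
  case: (boolP (Q j)) => Qj; last by rewrite ip0r andbF.
  by rewrite ov (eqP Qj) l0.
have sF k : spanned ip G (F k).
  apply: spanned_seq_of => i; case: ifP => Pi; last by move=> x _; rewrite ip0l.
  apply: (spanned_sub hip ov).
    move=> x /tv Bx; have := sB (e i) x; rewrite Bx ip0r diagE ipZl => /eqP.
    rewrite mulf_eq0 => /orP[|/eqP//] /eqP/(@complexI R) d0.
    by move: Pi; rewrite /P d0 => /eqP l00; rewrite -l00 ltxx in l0.
  move=> j Qj; apply: orth => d; move/negP: Qj; apply.
  by rewrite /Q -d.
have sG j : spanned ip F (G j).
  rewrite /G; case: ifP => Qj; last by move=> x _; rewrite ip0l.
  have := @spanned_sub _ _ _ hip _ _ (in_range P) (v j)
    (seq_of_orthonormal oe) (basis_spanned hip he (v j)).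
  rewrite (_ : (fun k => _) = F); last first.
    apply/funext => k; rewrite /F /seq_of /in_range.
    by case: (@pickle_inv I k).
  apply => k; rewrite /in_range /seq_of; case: (@pickle_inv I k) => [i|] /=; last by rewrite ip0r.
  move=> Pi; apply/ip_eq0C/orth => d; move/negP: Pi; apply.
  by rewrite /P d.
have -> : [set i | diag i = l] = [set i | P i] by apply/seteqP; split=> i /eqP.
have -> : [set j | s j = l] = [set j | Q j] by apply/seteqP; split=> j /eqP.
apply: (@card_of_esum R); [exact: countableP|exact: countableP|].
by rewrite -card_in_range (count_eq hip oF oG sF sG).
Qed.

Lemma eigen_index : exists h : I -> nat, [/\ 
  forall i, 0 < diag i -> s (h i) = diag i,
  forall i j, 0 < diag i -> 0 < diag j -> h i = h j -> i = j &
  forall j, 0 < s j -> exists2 i, 0 < diag i & h i = j].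
Proof.
have ex (l : R) : exists f : I -> nat,
    0 < l -> set_bij [set i | diag i = l] [set j | s j = l] f.
  have [l0|ln] := boolP (0 < l); last by exists (fun=> 0%N).
  by have /card_set_bijP[f] := level_card l0; exists f.
have [f fP] := choice ex; pose h i := f (diag i) i.
have sh i : 0 < diag i -> s (h i) = diag i.
  by move=> di; have [+ _ _] := fP _ di; apply.
exists h; split=> //.
- move=> i j di dj hij; have dij : diag i = diag j by rewrite -sh// hij sh.
  have [_ + _] := fP _ di; apply; rewrite ?inE//.
  by move: hij; rewrite /h -dij.
- move=> j sj; have [_ _ /(_ j erefl)[i /= di fi]] := fP _ sj.
  by exists i; rewrite ?di// /h di.
Qed.

End Diagonal.

(** * Conclusion *)

Section Assemble.
Local Open Scope card_scope.
Variables (R : realType) (H : completeNormedModType R[i]).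
Variable ip : {dot H for (@conjC R[i])}.
Hypothesis hip : hilbert_norm ip.
Variables (I : countType) (e : I -> H).
Hypothesis he : orthonormal_basis ip e.
Variables (A B : {linear H -> H}).
Hypothesis hB : compact_positive ip B.
Hypothesis hBD : diagonal_algebra ip e B.
Implicit Types (x y z : H).
Local Notation diag := (diag ip e B).

Lemma orbit_of_basis (g : I -> H) : orthonormal_family ip g -> total_family ip g ->
  (forall i, ip (A (g i)) (g i) = (diag i)%:C) -> cond_exp_unitary_orbit ip e A B.
Proof.
move=> og tg Ag.
have [U [U' [uU U'e]]] :=
  unitary_of_bases hip (basis_orthonormal he) og (basis_total hip he) tg.
have [|X XE] := @make_linear R H (fun x => U (A (U' x))).
  by move=> a x y; rewrite !linearP.
exists X; first by exists U, U'.
split=> // i; rewrite XE; case: uU => _ adj _ _.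
rewrite adj U'e Ag /diag quadE//.
by case: hB.
Qed.

(** Indices in [Z] receive a kernel vector directly; the others take, through [h], the vectors that
    [core] makes from [f]. *)
Lemma orbit_of_eigenvectors (Z : pred I) (zI : I -> H) (act : pred nat)
    (f : nat -> H) (eta xi : nat -> R) (h : I -> nat) :
  (forall j k, (j <= k)%N -> act k -> act j) ->
  (forall j k, (j <= k)%N -> xi k <= xi j) -> (forall j, 0 <= xi j) ->
  (forall a : R, 0 < a -> exists j, xi j <= a) ->
  (forall j, ~~ act j -> xi j = 0 /\ eta j = 0) ->
  (forall j, 0 <= eta j) -> dominates eta xi -> tight eta xi ->
  orthonormal_on ip act f -> (forall j, A (f j) = (eta j)%:C *: f j) ->
  (forall i j, ip (zI i) (zI j) = ((i == j) && Z j)%:R) ->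
  (forall i, A (zI i) = 0) -> (forall i j, ip (zI i) (f j) = 0) ->
  (forall x, (forall i, ip x (zI i) = 0) -> (forall j, ip x (f j) = 0) -> x = 0) ->
  (forall i, Z i -> diag i = 0) ->
  (forall i, ~~ Z i -> act (h i) /\ xi (h i) = diag i) ->
  (forall i j, ~~ Z i -> ~~ Z j -> h i = h j -> i = j) ->
  (forall n, act n -> exists2 i, ~~ Z i & h i = n) ->
  cond_exp_unitary_orbit ip e A B.
Proof.
move=> act_down xiN xi_ge0 xi0 inact eta_ge0 dom tg of_ Af oz Az zf tot Zd hact hinj hsurj.
have df : diagonalizes ip A f eta.
  move=> i j; rewrite Af ipZl of_; have [<-|ij] := eqVneq i j; last by rewrite !mulr0.
  by case: (boolP (act i)) => // /inact[_ ->]; rewrite !mul0r.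
have [g [og Ag gf]] :=
  core act_down xiN xi_ge0 (fun j nj => (inact j nj).1) xi0 of_ df eta_ge0 dom tg.
have zg i n : ip (zI i) (g n) = 0 by apply: (gf (zI i)).2.
pose gI i := if Z i then zI i else g (h i).
apply: (@orbit_of_basis gI).
- move=> i j; rewrite /gI; case: (boolP (Z i)) => Zi; case: (boolP (Z j)) => Zj.
  + by rewrite oz Zj andbT.
  + by rewrite zg; case: eqVneq => // ij; rewrite -ij Zi in Zj.
  + by rewrite (ip_eq0C (zg _ _)); case: eqVneq => // ij; rewrite ij Zj in Zi.
  + rewrite og (hact _ Zj).1 andbT; congr ((nat_of_bool _)%:R).
    by apply/eqP/eqP => [|->//]; exact: hinj.
- move=> x xg; apply: tot => [i|].
    have [Zi|Zi] := boolP (Z i); first by have := xg i; rewrite /gI Zi.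
    have -> : zI i = 0 by apply: (@ip_eq0 _ _ ip); rewrite oz (negPf Zi) andbF.
    exact: ip0r.
  apply/gf => n; have [an|an] := boolP (act n); last by rewrite (inactive0 og an) ip0r.
  have [i Zi <-] := hsurj n an; have := xg i.
  by rewrite /gI (negPf Zi).
- move=> i; rewrite /gI; case: ifPn => Zi; first by rewrite Az ip0l Zd.
  by rewrite Ag (hact _ Zi).2.
Qed.

End Assemble.

Section Cases.
Local Open Scope card_scope.
Variables (R : realType) (H : completeNormedModType R[i]).
Variable ip : {dot H for (@conjC R[i])}.
Hypothesis hip : hilbert_norm ip.
Variables (I : countType) (e : I -> H).
Hypothesis he : orthonormal_basis ip e.
Variables (A B : {linear H -> H}).
Hypothesis hA : compact_positive ip A.
Hypothesis hB : compact_positive ip B.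
Hypothesis hBD : diagonal_algebra ip e B.
Implicit Types (x y z : H).
Local Notation diag := (diag ip e B).

Variables (sA sB : nat -> R) (v z : nat -> H) (KA KB : option nat).
Hypothesis sA_ge0 : forall j, 0 <= sA j.
Hypothesis sAN : forall j k, (j <= k)%N -> sA k <= sA j.
Hypothesis sB_ge0 : forall j, 0 <= sB j.
Hypothesis sBN : forall j k, (j <= k)%N -> sB k <= sB j.
Hypothesis sA0 : forall a : R, 0 < a -> exists j, sA j <= a.
Hypothesis sB0 : forall a : R, 0 < a -> exists j, sB j <= a.
Hypothesis hv : eigenbasis ip A sA v.
Hypothesis oz : orthonormal_on ip (below KA) z.
Hypothesis Az : forall j, A (z j) = 0.
Hypothesis tz : forall y, A y = 0 -> spanned ip z y.
Hypothesis KBdiag : [set i | diag i == 0] #= belowS KB.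
Variable h : I -> nat.
Hypothesis hs : forall i, 0 < diag i -> sB (h i) = diag i.
Hypothesis hinj : forall i j, 0 < diag i -> 0 < diag j -> h i = h j -> i = j.
Hypothesis hsurj : forall j, 0 < sB j -> exists2 i, 0 < diag i & h i = j.
Hypothesis dom : dominates sA sB.
Hypothesis cof : cofinal sA sB.

Let ov : orthonormal_on ip (fun j => 0 < sA j) v. Proof. by case: hv. Qed.
Let Av j : A (v j) = (sA j)%:C *: v j. Proof. by case: hv. Qed.

Lemma vz_orth i j : ip (v i) (z j) = 0.
Proof.
have [si|si] := boolP (0 < sA i); last by rewrite (inactive0 ov si) ip0l.
apply: (eigen_orth hA (Av i) (b := 0)); first by rewrite Az scale0r.
by move=> s0; rewrite s0 ltxx in si.
Qed.

Lemma vz_total x : (forall i, ip x (v i) = 0) -> (forall j, ip x (z j) = 0) -> x = 0.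
Proof.
move=> xv xz; apply: (@ip_eq0 _ _ ip); apply: (tz _ xz).
by case: hv => _ _; apply.
Qed.

Lemma diag_cases i : (0 < diag i) = (diag i != 0).
Proof. by rewrite lt_neqAle (diag_ge0 e hB) andbT eq_sym. Qed.

Definition oadd (n : nat) (K : option nat) := omap (addn n) K.

Lemma below_oadd n K j : below (oadd n K) j = (j < n)%N || below K (j - n).
Proof. case: K => [q|] /=; last by rewrite orbT. by apply/idP/orP; lia. Qed.

Definition append (n : nat) (u w : nat -> H) j := if (j < n)%N then u j else w (j - n)%N.

Lemma append_orth n u w x : (forall j, ip x (append n u w j) = 0) <->
  (forall j, (j < n)%N -> ip x (u j) = 0) /\ (forall j, ip x (w j) = 0).
Proof.
rewrite /append; split=> [xa|[xu xw] j]; last by case: ifP => [/xu|].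
split=> j; first by move=> jn; have := xa j; rewrite jn.
by have := xa (n + j)%N; rewrite ltnNge leq_addr /= addKn.
Qed.

Section FiniteRank.
Variable M : nat.
Hypothesis sM : forall j, (0 < sA j) = (j < M)%N.

Let sAM j : (M <= j)%N -> sA j = 0.
Proof.
move=> Mj; apply/eqP; rewrite eq_le sA_ge0 andbT leNgt sM -leqNgt.
exact: Mj.
Qed.

Lemma append_orthonormal K w : orthonormal_on ip (below K) w ->
  (forall i j, ip (v i) (w j) = 0) ->
  orthonormal_on ip (below (oadd M K)) (append M v w).
Proof.
move=> ow vw i j; rewrite /append below_oadd.
case: ltnP => iM; case: ltnP => jM.
- by rewrite ov sM jM.
- by rewrite vw ltn_eqF// (leq_trans iM).
- by rewrite (ip_eq0C (vw _ _)) gtn_eqF// (leq_trans jM).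
- rewrite ow; congr ((nat_of_bool (_ && _))%:R); apply/eqP/eqP; lia.
Qed.

Lemma append_eigen w j : (forall j, A (w j) = 0) ->
  A (append M v w j) = (sA j)%:C *: append M v w j.
Proof.
move=> Aw; rewrite /append; case: ltnP => jM; first exact: Av.
by rewrite Aw sAM// scale0r.
Qed.

Lemma tight_sA : tight sA sB.
Proof. exact: tight_finite cof sAM. Qed.

(** The first [M] vectors [v] and the active [z] form an orthonormal basis, as does [e]. *)
Lemma card_index : [set: I] #= belowS (oadd M KA).
Proof.
apply: (@card_of_esum R); [exact: countableP|exact: countableP|].
have of_ := append_orthonormal oz vz_orth.
rewrite [RHS](_ : _ = \esum_(k in [set k | below (oadd M KA) k]) 1%E)//.
rewrite (count_eq hip of_ (seq_of_orthonormal (basis_orthonormal he))).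
- by rewrite card_in_range; congr esum; apply/seteqP; split.
- by move=> k; exact: (basis_spanned hip he).
- move=> k; apply: spanned_seq_of => i x /append_orth[xv xz].
  suff -> : x = 0 by rewrite ip0r.
  apply: vz_total => // j; have [jM|Mj] := ltnP j M; first exact: xv.
  by rewrite (inactive0 ov) ?ip0r// sM -leqNgt.
Qed.

End FiniteRank.

Lemma rank_exists (s : nat -> R) : (forall j, 0 <= s j) ->
  (forall j k, (j <= k)%N -> s k <= s j) -> (exists n, s n = 0) ->
  exists M, forall j, (0 < s j) = (j < M)%N.
Proof.
move=> s0 sN [n0 sn0].
have ex : exists n, s n == 0 by exists n0; apply/eqP.
have [M /eqP sM minM] := ex_minnP ex; exists M => j.
rewrite lt_neqAle s0 andbT eq_sym; apply/idP/idP => [|jM].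
  by apply: contraNT; rewrite -leqNgt => /sN; rewrite sM eq_le s0 andbT.
by apply: contraL jM => /minM; rewrite -leqNgt.
Qed.

Lemma belowS_inj K K' : belowS K #= belowS K' -> K = K'.
Proof.
move=> KK'; apply: (@ereal_of_onat_inj R).
by rewrite -(esum_card R KK') esum_belowS.
Qed.

(** All of ker A is appended to the positive eigenvalues and the zero entries of B stay among the
    targets, so [Z] is empty. The active lengths agree because N + KB and M + KA both count the
    index set. *)
Lemma orbit_finite_rank : (exists n, sB n = 0) -> cond_exp_unitary_orbit ip e A B.
Proof.
move=> sBfin; have [N rB] := rank_exists sB_ge0 sBN sBfin.
have sBNz j : (N <= j)%N -> sB j = 0.
  by move=> Nj; apply/eqP; rewrite eq_le sB_ge0 andbT leNgt rB -leqNgt.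
have sAN0 : sA N = 0.
  apply/eqP; rewrite eq_le sA_ge0 andbT leNgt; apply/negP => sAN_gt0.
  (* The sums of [sB] stop growing at N, where those of [sA] already dominate them, so by cofinality
     [sA] has nothing left there. *)
  have e2 : 0 < sA N / 2 by lra.
  have [m] := cof N.+1 e2; rewrite big_ord_recr/=.
  have := psum_le sB_ge0 (leq_maxr N m).
  rewrite (psum_stable sBNz (leq_maxl N m)).
  by have := dom N; rewrite /defect; lra.
have [M rA] := rank_exists sA_ge0 sAN (ex_intro _ N sAN0).
have /card_set_bijP[h0 [h0K h0inj h0surj]] := KBdiag.
pose h' i := if 0 < diag i then h i else (N + h0 i)%N.
have hN i : 0 < diag i -> (h i < N)%N by move=> di; rewrite -rB hs.
have d0 i : ~~ (0 < diag i) -> diag i = 0 by rewrite diag_cases negbK => /eqP.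
have h'K i : below (oadd N KB) (h' i).
  rewrite below_oadd /h'; case: (boolP (0 < diag i)) => di; first by rewrite hN.
  by rewrite addKn (h0K i _ : below KB _) ?orbT//=; apply/eqP/d0.
have h'inj i j : h' i = h' j -> i = j.
  rewrite /h'; case: (boolP (0 < diag i)) => di; case: (boolP (0 < diag j)) => dj.
  - exact: hinj.
  - by have := hN _ di => + hE; rewrite hE ltnNge leq_addr.
  - by have := hN _ dj => + hE; rewrite -hE ltnNge leq_addr.
  - by move/addnI => hE; apply: h0inj; rewrite ?inE//=; apply/eqP/d0.
have h'surj n : below (oadd N KB) n -> exists i, h' i = n.
  rewrite below_oadd; case: ltnP => [nN _|Nn /= nK].
    by have [|i di hi] := @hsurj n; [rewrite rB | exists i; rewrite /h' di].
  have [i /= /eqP di h0i] := h0surj _ nK; exists i.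
  by rewrite /h' di ltxx h0i subnKC.
have KE : oadd N KB = oadd M KA.
  apply: belowS_inj; apply: card_eq_trans (card_index rA).
  rewrite card_eq_sym; apply/card_set_bijP; exists h'; split.
  - by move=> i _; exact: h'K.
  - by move=> i j _ _; exact: h'inj.
  - by move=> n /h'surj[i hi]; exists i.
apply: (@orbit_of_eigenvectors _ _ _ hip _ _ he _ _ hB hBD pred0 (fun=> 0)
  (below (oadd M KA)) (append M v z) sA sB h') => //.
- by move=> j k; exact: below_le.
- move=> j nj; split.
    by apply: sBNz; move: nj; rewrite -KE below_oadd; lia.
  apply/eqP; rewrite eq_le sA_ge0 andbT leNgt rA.
  by move: nj; rewrite below_oadd; lia.
- exact: tight_sA rA.
- by apply: append_orthonormal; [exact: rA|exact: oz|exact: vz_orth].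
- by move=> j; exact: append_eigen.
- by move=> i j; rewrite ip0l andbF.
- by move=> i; exact: linear0.
- by move=> i j; rewrite ip0l.
- move=> x _ /append_orth[xv xz]; apply: vz_total => // j.
  have [jM|Mj] := ltnP j M; first exact: xv.
  by rewrite (inactive0 ov) ?ip0r// rA -leqNgt.
- move=> i _; split; first by rewrite -KE.
  rewrite /h'; case: (boolP (0 < diag i)) => di; first exact: hs.
  by rewrite sBNz ?leq_addr// d0.
- by move=> i j _ _; exact: h'inj.
- by move=> n; rewrite -KE => /h'surj[i hi]; exists i.
Qed.

Section Split.
Hypothesis sB_gt0 : forall j, 0 < sB j.
Variables (K1 : option nat) (theta rho : nat -> nat).
Hypothesis thetaK : forall k, below KB k -> below KA (theta k).
Hypothesis theta_inj : forall j k, below KB j -> below KB k -> theta j = theta k -> j = k.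
Hypothesis rhoK : forall k, below K1 k -> below KA (rho k).
Hypothesis rho_inj : forall j k, below K1 j -> below K1 k -> rho j = rho k -> j = k.
Hypothesis disj : forall j k, below KB j -> below K1 k -> theta j <> rho k.
Hypothesis cover : forall n, below KA n ->
  (exists2 k, below KB k & theta k = n) \/ (exists2 k, below K1 k & rho k = n).
Hypothesis K1fin : (exists n, sA n = 0) -> K1 = None.
Hypothesis K1inf : (forall j, 0 < sA j) -> forall k, below K1 k ->
  exists N, forall n, (N <= n)%N ->
    \sum_(j < n + k.+1) sB j <= \sum_(j < n) sA j.

(** [theta] selects the kernel vectors matched with zero entries of B and [rho] the [K1] remaining
    ones, which enter the list. They follow the positive eigenvalues if A has finite rank, where
    [K1 = None] makes the list infinite, and are interleaved with them otherwise. *)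
Lemma orbit_split : cond_exp_unitary_orbit ip e A B.
Proof.
have /card_set_bijP[h0 [h0K h0inj h0surj]] := KBdiag.
pose Z i := diag i == 0.
pose zI i := if Z i then z (theta (h0 i)) else 0.
pose y k := if below K1 k then z (rho k) else 0.
have oy : orthonormal_on ip (below K1) y.
  move=> j k; rewrite /y; case: (boolP (below K1 j)) => Kj; last first.
    by rewrite ip0l; case: eqVneq => // <-; rewrite (negPf Kj).
  case: (boolP (below K1 k)) => Kk; last by rewrite ip0r andbF.
  rewrite oz rhoK// !andbT; congr ((nat_of_bool _)%:R).
  by apply/eqP/eqP => [/rho_inj|->//]; exact.
have ozI i j : ip (zI i) (zI j) = ((i == j) && Z j)%:R.
  rewrite /zI; case: (boolP (Z i)) => Zi; last first.
    by rewrite ip0l; case: eqVneq => // <-; rewrite (negPf Zi).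
  case: (boolP (Z j)) => Zj; last by rewrite ip0r andbF.
  have h0i := h0K i Zi; have h0j := h0K j Zj.
  rewrite oz thetaK// !andbT; congr ((nat_of_bool _)%:R).
  apply/eqP/eqP => [/theta_inj|->//] => /(_ h0i h0j).
  by apply: h0inj; rewrite inE.
have zIy i k : ip (zI i) (y k) = 0.
  rewrite /zI /y; case: ifPn => [Zi|_]; last by rewrite ip0l.
  case: ifPn => [Kk|_]; last by rewrite ip0r.
  rewrite oz; case: eqVneq => // E; have := disj (h0K i Zi) Kk E.
  by [].
have vy i k : ip (v i) (y k) = 0.
  by rewrite /y; case: ifP => _; rewrite ?ip0r// vz_orth.
have zIv i k : ip (zI i) (v k) = 0.
  by apply: ip_eq0C; rewrite /zI; case: ifP => _; rewrite ?ip0r// vz_orth.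
have Ay k : A (y k) = 0 by rewrite /y; case: ifP => _; rewrite ?Az ?linear0.
have AzI i : A (zI i) = 0 by rewrite /zI; case: ifP => _; rewrite ?Az ?linear0.
have tot x : (forall i, ip x (zI i) = 0) -> (forall j, ip x (v j) = 0) ->
    (forall k, ip x (y k) = 0) -> x = 0.
  move=> xz xv xy; apply: vz_total => // n.
  have [Kn|Kn] := boolP (below KA n); last by rewrite (inactive0 oz) ?ip0r.
  have [[k Kk <-]|[k Kk <-]] := cover Kn.
    have [i /= Zi <-] := h0surj k Kk.
    by have := xz i; rewrite /zI /Z Zi.
  by have := xy k; rewrite /y Kk.
have Zd i : ~~ Z i -> 0 < diag i by rewrite diag_cases.
have finish f eta : (forall j, 0 <= eta j) -> dominates eta sB -> tight eta sB ->
    orthonormal_on ip predT f -> (forall j, A (f j) = (eta j)%:C *: f j) ->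
    (forall i j, ip (zI i) (f j) = 0) ->
    (forall x, (forall j, ip x (f j) = 0) ->
      (forall j, ip x (v j) = 0) /\ (forall k, ip x (y k) = 0)) ->
    cond_exp_unitary_orbit ip e A B.
  move=> eta0 deta teta of_ Af zf fvy.
  apply: (@orbit_of_eigenvectors _ _ _ hip _ _ he _ _ hB hBD Z zI predT f eta sB h) => //.
  - by move=> x xz /fvy[xv xy]; exact: tot.
  - by move=> i /eqP.
  - by move=> i /Zd di; split=> //; exact: hs.
  - by move=> i j /Zd di /Zd dj; exact: hinj.
  - move=> n _; have [i di hi] := hsurj (sB_gt0 n); exists i => //.
    by rewrite /Z -diag_cases.
have [sAfin|sAinf] := pselect (exists n, sA n = 0).
  have [M rA] := rank_exists sA_ge0 sAN sAfin; have K1N := K1fin sAfin.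
  apply: (finish (append M v y) sA) => //.
  - exact: tight_sA rA.
  - apply: orthonormal_on_eq (append_orthonormal rA oy vy) => j.
    by rewrite below_oadd K1N orbT.
  - by move=> j; exact: append_eigen.
  - by move=> i j; rewrite /append; case: ifP.
  - move=> x /append_orth[xv xy]; split=> // j.
    have [jM|Mj] := ltnP j M; first exact: xv.
    by rewrite (inactive0 ov) ?ip0r// rA -leqNgt.
have sA_gt0 j : 0 < sA j.
  by rewrite lt_neqAle sA_ge0 andbT; apply/eqP => sj; apply: sAinf; exists j.
have [tau [tau_inj tau_l tau_r [domE tE]]] :=
  arrangement sAN sA0 sA_gt0 sB_ge0 cof dom (K1inf sA_gt0) sBN sB0.
pose f n := match tau n with inl a => v a | inr b => y b end.
apply: (finish f _ _ domE tE).
- by move=> j; case: (tau j).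
- move=> m n; have -> : (m == n) = (tau m == tau n) by rewrite (inj_eq tau_inj).
  rewrite /f andbT; case em : (tau m) => [a|b]; case en : (tau n) => [a'|b'].
  + by rewrite ov sA_gt0 andbT.
  + exact: vy.
  + exact/ip_eq0C/vy.
  + have Kb : below K1 b' by apply/tau_r; exists n.
    by rewrite oy Kb andbT.
- by move=> n; rewrite /f; case: (tau n) => a; rewrite ?Ay ?scale0r.
- by move=> i n; rewrite /f; case: (tau n) => a.
- move=> x xf; split=> [a|b].
    by have [n tn] := tau_l a; have := xf n; rewrite /f tn.
  have [Kb|Kb] := boolP (below K1 b); last by rewrite (inactive0 oy) ?ip0r.
  by have [n tn] := (tau_r b).2 Kb; have := xf n; rewrite /f tn.
Qed.

End Split.

(** B of infinite rank makes the index set infinite, and a finite rank of A leaves an infinite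
    kernel. *)
Lemma infinite_rank_kernel : (forall j, 0 < sB j) -> (exists n, sA n = 0) -> KA = None.
Proof.
move=> sB_gt0 /(rank_exists sA_ge0 sAN)[M rA].
have := card_index rA; case: KA => // a aI; exfalso; apply: infinite_nat.
apply: (@sub_finite_set _ _ (h @` setT)).
  by move=> n _; have [i _ hi] := hsurj (sB_gt0 n); exists i.
by apply: finite_image; exists (M + a)%N.
Qed.

Lemma orbit_infinite_rank (p : option nat) : (forall j, 0 < sB j) ->
  pmajorized p sB sA -> (ereal_of_onat R KB <= ereal_of_onat R KA)%E ->
  (ereal_of_onat R KA <= ereal_of_onat R KB + ereal_of_onat R p)%E ->
  cond_exp_unitary_orbit ip e A B.
Proof.
move=> sB_gt0 maj; have kerA := infinite_rank_kernel sB_gt0.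
(* [below (omap S p) q] encodes q <= p, for infinite p too. *)
have pdom q : below (omap S p) q -> exists N, forall n, (N <= n)%N ->
    \sum_(j < n + q) sB j <= \sum_(j < n) sA j.
  case: p maj => [r|] maj; last by move=> _; have [_] := maj q.
  rewrite /= ltnS => qr; have [_ [N HN]] := maj; exists N => n Nn.
  by apply: le_trans (HN n Nn); apply: psum_le => //; rewrite leq_add2l.
(* With finite ker B of dimension b, the first b kernel vectors of A are matched and the rest is
   shifted down by b. *)
have none_case : forall (b : nat), KB = Some b -> forall K1 : option nat,
    (forall k, below K1 k <-> below KA (b + k)%N) ->
    (forall k, below KB k -> below KA k) ->
    (KA = None -> K1 = None) -> (forall k, below K1 k -> below (omap S p) k.+1) ->
    cond_exp_unitary_orbit ip e A B.
  move=> b KBb K1 K1A KBA K1N K1p.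
  apply: (@orbit_split sB_gt0 K1 id (addn b)) => //.
  - by move=> k /K1A.
  - by move=> j k _ _ /addnI.
  - by move=> j k; rewrite KBb /= => jb _ E; move: jb; rewrite E ltnNge leq_addr.
  - move=> n Kn; rewrite KBb /=; have [nb|bn] := ltnP n b; first by left; exists n.
    by right; exists (n - b)%N; rewrite ?subnKC//; apply/K1A; rewrite subnKC.
  - by move=> /kerA/K1N.
  - by move=> _ k /K1p/pdom.
case EB : KB none_case => [b|]; case EA : KA kerA => [a|] kerA none_case //=.
- rewrite -?EFinD !lee_fin ler_nat => ba ap.
  apply: (none_case b erefl (Some (a - b)%N)) => //.
  + by move=> k /=; split; lia.
  + by move=> k /=; lia.
  + move: ap; case: (p) => [r|] //=; rewrite -EFinD lee_fin -natrD ler_nat.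
    by move=> ar k; lia.
- move=> _; case Ep : (p) => [r|] // _.
  by apply: (none_case b erefl None) => // k; rewrite Ep.
(* Both kernels are infinite, so the division is free. A finite-rank A needs infinitely many zeros
   in its list, and odd indices supply them; otherwise all kernel vectors are matched with zero
   entries of B. *)
- move=> _ _; have [sAfin|sAinf] := pselect (exists n, sA n = 0).
    apply: (@orbit_split sB_gt0 None double (fun k => k.*2.+1)) => //; rewrite ?EA ?EB//.
    + by move=> j k _ _ /double_inj.
    + by move=> j k _ _ [] /double_inj.
    + by move=> j k _ _; lia.
    + move=> n _; rewrite -(odd_double_half n).
      by case: (odd n); [right|left]; exists n./2.
    + by move=> sA_gt0; case: sAfin => n sn; have := sA_gt0 n; rewrite sn ltxx.
  apply: (@orbit_split sB_gt0 (Some 0%N) id id) => //; rewrite ?EA ?EB//.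
  by move=> n _; left; exists n.
Qed.

End Cases.

Theorem theorem2p4 (R : realType) (H : completeNormedModType R[i])
    (ip : {dot H for (@conjC R[i])}) (hip : hilbert_norm ip)
    (I : countType) (e : I -> H) (he : orthonormal_basis ip e)
    (A B : {linear H -> H})
    (hA : compact_positive ip A) (hB : compact_positive ip B)
    (hBD : diagonal_algebra ip e B)
    (RA RB : {linear H -> H})
    (hRA : range_projection ip A RA) (hRB : range_projection ip B RB)
    (sA sB : nat -> R)
    (hsA : singular_values A sA) (hsB : singular_values B sB)
    (hker : (cotrace ip e RB <= cotrace ip e RA)%E)
    (hp : exists p : option nat,
        pmajorized p sB sA /\
        (cotrace ip e RA <= cotrace ip e RB + ereal_of_onat R p)%E) :
  cond_exp_unitary_orbit ip e A B.
Proof.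
have [v hv] := singular_basis hip hA hsA; have [w hw] := singular_basis hip hB hsB.
have [sA_ge0 sAN _] := hsA; have [sB_ge0 sBN _] := hsB.
have sA0 := eigenbasis_to0 hip hA hv sAN; have sB0 := eigenbasis_to0 hip hB hw sBN.
have [KA [z [oz Az tz cotA]]] := kernel_basis hip he hA hRA.
have [KB KBdiag] := enum_countable (countableP [set i | diag ip e B i == 0]).
have cotB : cotrace ip e RB = ereal_of_onat R KB.
  by rewrite (cotrace_diag hip he hB hBD hRB) (esum_card R KBdiag).
have [h [hs hinj hsurj]] := eigen_index hip he hB hBD hw.
rewrite cotA cotB in hker hp; have [p [pmaj KAp]] := hp.
have maj : majorized sB sA by case: (p) pmaj => [q [] //|/(_ 0%N)[]].
have dom : dominates sA sB by move=> n; rewrite /defect subr_ge0; exact: maj.1.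
have cof := majorized_cofinal sB_ge0 sA_ge0 maj.
have [sBfin|sBinf] := pselect (exists n, sB n = 0).
  exact: (orbit_finite_rank hip he hA hB hBD sA_ge0 sAN sB_ge0 sBN sB0 hv oz
    Az tz KBdiag hs hinj hsurj dom cof sBfin).
have sB_gt0 j : 0 < sB j.
  by rewrite lt_neqAle sB_ge0 andbT; apply/eqP => sj; apply: sBinf; exists j.
exact: (orbit_infinite_rank hip he hA hB hBD sA_ge0 sAN sB_ge0 sBN sA0 sB0 hv oz
  Az tz KBdiag hs hinj hsurj dom cof sB_gt0 pmaj hker KAp).
Qed.
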